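(* Two Hadamard matrices are quantum isomorphic if and only if they have the same size.
   Context: Hadamard matrix of size $N$: an $N\times N$ matrix $H$ with entries $\pm1$ and $HH^{T}=N\cdot I=H^{T}H$. A matrix $q=(q^i_j)$ (possibly rectangular) with entries in a unital $*$-algebra is cubic if it is orthogonal ($q^i_j=(q^i_j)^*$, $qq^{T}=1$, $q^{T}q=1$) and $q^i_jq^i_k=0=q^j_iq^k_i$ for $j\neq k$. Hadamard matrices $H$ (size $N$) and $H'$ (size $N'$) are quantum isomorphic if there exists a (nonzero, unital) $*$-algebra $\mathscr{A}$ generated by the entries of a cubic $N'\times N$ matrix $q$ over $\mathscr{A}$ such that $p=H'qH^{-1}$ is also a cubic matrix. *)

(* Defs.v *)
From HB Require Import structures.
From mathcomp Require Import all_boot all_order all_algebra.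
From mathcomp Require Import complex.
From mathcomp Require Import reals.

Set Implicit Arguments.
Unset Strict Implicit.
Unset Printing Implicit Defensive.

Import Order.TTheory GRing.Theory Num.Theory.
Local Open Scope ring_scope.

HB.mixin Record isStarAlgebra (C : numClosedFieldType) A
    of GRing.Algebra C A := {
  star : A -> A ;
  starK : involutive star ;
  starD : {morph star : x y / x + y} ;
  starM : forall x y : A, star (x * y) = star y * star x ;
  starZ : forall (a : C) (x : A), star (a *: x) = Num.conj a *: star x
}.

(* Unital, not necessarily commutative; 1 != 0 is inherited from algType. *)
#[short(type="starAlgType")]
HB.structure Definition StarAlgebra (C : numClosedFieldType) :=
  { A of isStarAlgebra C A & GRing.Algebra C A }.

Section Cubic.
Variables (C : numClosedFieldType) (A : starAlgType C).

Definition orthogonal_mx (m n : nat) (q : 'M[A]_(m, n)) : Prop :=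
  [/\ forall i j, star (q i j) = q i j,
      q *m q^T = 1%:M
    & q^T *m q = 1%:M].

Definition cubic (m n : nat) (q : 'M[A]_(m, n)) : Prop :=
  [/\ orthogonal_mx q,
      forall i j k, j != k -> q i j * q i k = 0
    & forall i j k, j != k -> q j i * q k i = 0].

Record star_subalgebra (S : A -> Prop) : Prop := {
  star_subalgebra1 : S 1 ;
  star_subalgebraD : forall x y, S x -> S y -> S (x + y) ;
  star_subalgebraZ : forall (a : C) x, S x -> S (a *: x) ;
  star_subalgebraM : forall x y, S x -> S y -> S (x * y) ;
  star_subalgebra_star : forall x, S x -> S (star x)
}.

Definition generated_by_entries (m n : nat) (q : 'M[A]_(m, n)) : Prop :=
  forall S : A -> Prop,
    star_subalgebra S -> (forall i j, S (q i j)) -> forall x, S x.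

(* Scalar matrices act on matrices over A through the unit map C -> A. *)
Definition to_alg (m n : nat) (M : 'M[C]_(m, n)) : 'M[A]_(m, n) :=
  map_mx (in_alg A) M.

End Cubic.

Definition hadamard (C : numClosedFieldType) (N : nat) (H : 'M[C]_N) : Prop :=
  [/\ forall i j, H i j = 1 \/ H i j = -1,
      H *m H^T = (N%:R)%:M
    & H^T *m H = (N%:R)%:M].

Definition quantum_isomorphic (C : numClosedFieldType) (N N' : nat)
    (H : 'M[C]_N) (H' : 'M[C]_N') : Prop :=
  exists (A : starAlgType C) (q : 'M[A]_(N', N)),
    [/\ cubic q,
        generated_by_entries q
      & cubic (to_alg A H' *m q *m to_alg A (invmx H))].

(* Main.v *)
From HB Require Import structures.
Require Import Defs.
From mathcomp Require Import all_boot all_order all_algebra.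
From mathcomp Require Import complex reals.
From mathcomp Require Import boolp functions ring.

Set Implicit Arguments.
Unset Strict Implicit.
Unset Printing Implicit Defensive.

Import GRing.Theory Num.Theory.
Local Open Scope ring_scope.

(** The size is visible in any nonzero algebra: if [q *m q^T] and [q^T *m q] are
  identity matrices, then summing the squares of all entries of [q] by rows or
  by columns gives the number of rows and the number of columns
  ([orthogonal_mx_size]).

  Conversely, let [H] and [H'] have size [N].  The difficulty is to show that
  the algebra presented by the entries of [q] and the required relations is not
  zero.  This is reduced to a scalar question in two moves.

  - The star is free of charge.  All relations are stable under reversing the
    order of products and have real coefficients.  So whenever operators
    [Q (i, j)] on a nonzero vector space satisfy the relations, the pairs
    (word in the operators, reversed word) form a *-algebra in which the star
    exchanges the two components ([quantum_isomorphic_of_operators]).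
  - Such operators exist as soon as some linear functional on noncommutative
    polynomials kills the ideal of relations but not the constant 1.  The
    functionals killing the ideal form a vector space on which letters act by
    shifting words ([quantum_isomorphic_same_size]).

  The functional is [amplitude].  It comes from the fact that the quantum
  symmetries of a Hadamard matrix are governed by two commuting copies of the
  Temperley-Lieb category with loop value the square root of [N].  Draw each
  letter of a word, an index of the standard basis, as two adjacent parallel
  strands, one of kind v and one of kind w, in the planar order
  v w, w v, v w, w v and so on; the index is a spin placed in the region
  between the two strands.  Strands of the same kind never cross.  The four
  regions around a crossing of a v with a w are two opposite regions without
  spin and two opposite regions that carry an index of a row and an index of a
  column, and the crossing is weighted by the corresponding entry of [H].
  Orthogonality of the rows and columns of [H] and the equation 1 = (+-1)^2 say
  exactly that such pictures may be deformed by sliding strands of different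
  kinds over one another.  Sliding all strands v to the left of all strands w
  turns a word of 2r letters into an array [state] indexed by r spins [ys]
  (between paired strands v) and r spins [bs] (between paired strands w).
  In these coordinates each relation on two neighbouring letters is expressed
  by an operator that does not mention [H]: averaging over one spin, forcing
  two neighbouring spins to be equal, or inserting two free spins.
  Consequently the pairing of the array of a word for [H'] with the array of a
  word for [H] satisfies all relations.

  Pulling one pair of strands v across r pairs of strands w is the operator
  [transfer].  It is the r-th tensor power of the magic unitary [magic], formed
  by the rank one projections on the entrywise products of two rows.  An
  operator on the last spins [bs] passes through later letters because it
  commutes with every transfer; [pairing_slide] records this, together with
  the transposition that carries it from one side of the pairing to the other.
  Neighbouring letters belong either to one pushed pair of letters or to two
  consecutive pairs; this is why each relation is checked twice, with the roles
  of v and w exchanged. *)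

(** * A star algebra from operators *)

(** The nonzero vector is part of the data so that the algebra built below, a
    type depending on the family, is nonzero without further hypotheses. *)
Record operator_family (C : numClosedFieldType) (J : Type) := OperatorFamily {
  op_space : lmodType C ;
  op_act : J -> {linear op_space -> op_space} ;
  op_vec : op_space ;
  op_vec_neq0 : op_vec != 0
}.

Section StarAlgebraOfOperators.
Variables (C : numClosedFieldType) (J : Type) (Q : operator_family C J).
Local Notation M := (op_space Q).

(** The second map is the word formed by the same operators in the opposite
    order with conjugated coefficients: it plays the part of an adjoint where
    no inner product is available. *)
Inductive opposite_words : (M -> M) -> (M -> M) -> Prop :=
| opposite_words1 : opposite_words id id
| opposite_words_op j : opposite_words (op_act Q j) (op_act Q j)
| opposite_wordsD f f' g g' : opposite_words f f' -> opposite_words g g' ->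
    opposite_words (f + g) (f' + g')
| opposite_wordsZ a f f' : opposite_words f f' ->
    opposite_words (a *: f) (Num.conj a *: f')
| opposite_wordsM f f' g g' : opposite_words f f' -> opposite_words g g' ->
    opposite_words (f \o g) (g' \o f').

Lemma opposite_words_sym f g : opposite_words f g -> opposite_words g f.
Proof.
elim=> {f g} [|j|????????|a f f' _ h|????????]; try by constructor.
by rewrite -{2}(conjCK a); constructor.
Qed.

Lemma opposite_words_linear f g : opposite_words f g ->
  forall a x y, f (a *: x + y) = a *: f x + f y.
Proof.
elim=> {f g} [|j|f f' g g' _ hf _ hg|a f f' _ hf|f f' g g' _ hf _ hg] b x y //=.
- exact: linearP.
- by rewrite !fctE hf hg scalerDr addrACA.
- by rewrite !fctE hf scalerDr !scalerA mulrC.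
- by rewrite hg hf.
Qed.

Definition op_pair_pred : {pred (M -> M) * (M -> M)} :=
  fun fg => `[< opposite_words fg.1 fg.2 >].

Lemma op_pair_zmod_closed : zmod_closed op_pair_pred.
Proof.
split=> [|[f f'] [g g']].
  apply/asboolP; rewrite /= -(scale0r (id : M -> M)).
  by rewrite -{2}(conjC0 C); constructor; constructor.
move=> /asboolP h1 /asboolP h2; apply/asboolP=> /=.
rewrite -!scaleN1r; constructor=> //.
have -> : (-1 : C) *: g' = Num.conj (-1 : C) *: g'.
  by rewrite rmorphN rmorph1.
by constructor.
Qed.
HB.instance Definition _ := GRing.isZmodClosed.Build _ op_pair_pred
  op_pair_zmod_closed.

(** The operators and their reversed words are kept together: the product is
    ordinary on the first component and opposite on the second, so that
    exchanging components is an anti-automorphism. *)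
Record op_pair := OpPair {
  op_pair_val :> (M -> M) * (M -> M) ;
  op_pairP : op_pair_val \in op_pair_pred
}.
HB.instance Definition _ := [isSub for op_pair_val].
HB.instance Definition _ := [Choice of op_pair by <:].
HB.instance Definition _ := [SubChoice_isSubZmodule of op_pair by <:].

Lemma op_pair_wordsP (x : op_pair) : opposite_words (val x).1 (val x).2.
Proof. exact/asboolP/(valP x). Qed.

Definition make_op_pair f g (h : opposite_words f g) : op_pair :=
  @OpPair (f, g) (asboolT h).

Lemma op_pair_eq (x y : op_pair) :
  (forall v, (val x).1 v = (val y).1 v) ->
  (forall v, (val x).2 v = (val y).2 v) -> x = y.
Proof.
move=> h1 h2; apply: val_inj.
by case: (val x) (val y) h1 h2 => [f f'] [g g'] /= /funext-> /funext->.
Qed.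

Lemma op_pair_linear1 (x : op_pair) a u v :
  (val x).1 (a *: u + v) = a *: (val x).1 u + (val x).1 v.
Proof. exact: opposite_words_linear (op_pair_wordsP x) a u v. Qed.

Lemma op_pair_linear2 (x : op_pair) a u v :
  (val x).2 (a *: u + v) = a *: (val x).2 u + (val x).2 v.
Proof.
exact: opposite_words_linear (opposite_words_sym (op_pair_wordsP x)) a u v.
Qed.

Lemma op_pair_additive1 (x : op_pair) u v :
  (val x).1 (u + v) = (val x).1 u + (val x).1 v.
Proof. by rewrite -{1}[u]scale1r op_pair_linear1 scale1r. Qed.

Lemma op_pair_additive2 (x : op_pair) u v :
  (val x).2 (u + v) = (val x).2 u + (val x).2 v.
Proof. by rewrite -{1}[u]scale1r op_pair_linear2 scale1r. Qed.

Lemma op_pair_scalable1 (x : op_pair) a u :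
  (val x).1 (a *: u) = a *: (val x).1 u.
Proof.
have x0 : (val x).1 0 = 0.
  by apply: (addrI ((val x).1 0)); rewrite -op_pair_additive1 !addr0.
by rewrite -[a *: u]addr0 op_pair_linear1 x0 addr0.
Qed.

Lemma op_pair_scalable2 (x : op_pair) a u :
  (val x).2 (a *: u) = a *: (val x).2 u.
Proof.
have x0 : (val x).2 0 = 0.
  by apply: (addrI ((val x).2 0)); rewrite -op_pair_additive2 !addr0.
by rewrite -[a *: u]addr0 op_pair_linear2 x0 addr0.
Qed.

Definition op_pair1 : op_pair := make_op_pair opposite_words1.
Definition op_pair_mul (x y : op_pair) : op_pair :=
  make_op_pair (opposite_wordsM (op_pair_wordsP x) (op_pair_wordsP y)).
Definition op_pair_scale (a : C) (x : op_pair) : op_pair :=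
  make_op_pair (opposite_wordsZ a (op_pair_wordsP x)).
Definition op_pair_star (x : op_pair) : op_pair :=
  make_op_pair (opposite_words_sym (op_pair_wordsP x)).
Definition op_pair_gen (j : J) : op_pair :=
  make_op_pair (opposite_words_op j).

Lemma op_pair1_neq0 : op_pair1 != 0.
Proof.
apply: contra_neq (op_vec_neq0 Q).
move=> /(congr1 (fun x : op_pair => (val x).1 (op_vec Q))) /=.
by [].
Qed.

Fact op_pair_mulA : associative op_pair_mul.
Proof. by move=> x y z; apply: op_pair_eq. Qed.
Fact op_pair_mul1l : left_id op_pair1 op_pair_mul.
Proof. by move=> x; apply: op_pair_eq. Qed.
Fact op_pair_mul1r : right_id op_pair1 op_pair_mul.
Proof. by move=> x; apply: op_pair_eq. Qed.
Fact op_pair_mulDl : left_distributive op_pair_mul +%R.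
Proof.
move=> x y z; apply: op_pair_eq => v //=.
by rewrite ?raddfD /= !fctE op_pair_additive2.
Qed.
Fact op_pair_mulDr : right_distributive op_pair_mul +%R.
Proof.
move=> x y z; apply: op_pair_eq => v //=.
by rewrite ?raddfD /= !fctE op_pair_additive1.
Qed.
HB.instance Definition _ := GRing.Zmodule_isNzRing.Build op_pair
  op_pair_mulA op_pair_mul1l op_pair_mul1r op_pair_mulDl op_pair_mulDr
  op_pair1_neq0.

Fact op_pair_scaleA a b x :
  op_pair_scale a (op_pair_scale b x) = op_pair_scale (a * b) x.
Proof. by apply: op_pair_eq => v /=; rewrite !fctE scalerA ?rmorphM. Qed.
Fact op_pair_scale1 : left_id 1 op_pair_scale.
Proof.
by move=> x; apply: op_pair_eq => v /=; rewrite !fctE ?rmorph1 scale1r.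
Qed.
Fact op_pair_scaleDr : right_distributive op_pair_scale +%R.
Proof.
by move=> a x y; apply: op_pair_eq => v; exact: scalerDr.
Qed.
Fact op_pair_scaleDl x : {morph op_pair_scale^~ x : a b / a + b}.
Proof.
move=> a b; apply: op_pair_eq => v; first exact: scalerDl.
by rewrite /= rmorphD; exact: scalerDl.
Qed.
HB.instance Definition _ := GRing.Zmodule_isLmodule.Build C op_pair
  op_pair_scaleA op_pair_scale1 op_pair_scaleDr op_pair_scaleDl.

Fact op_pair_scaleAl (a : C) (x y : op_pair) : a *: (x * y) = (a *: x) * y.
Proof. by apply: op_pair_eq => v //=; rewrite !fctE /= op_pair_scalable2. Qed.
HB.instance Definition _ := GRing.Lmodule_isLalgebra.Build C op_pair
  op_pair_scaleAl.

Fact op_pair_scaleAr (a : C) (x y : op_pair) : a *: (x * y) = x * (a *: y).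
Proof. by apply: op_pair_eq => v //=; rewrite !fctE /= op_pair_scalable1. Qed.
HB.instance Definition _ := GRing.Lalgebra_isAlgebra.Build C op_pair
  op_pair_scaleAr.

Fact op_pair_starK : involutive op_pair_star.
Proof. by move=> x; apply: op_pair_eq. Qed.
Fact op_pair_starD : {morph op_pair_star : x y / x + y}.
Proof. by move=> x y; apply: op_pair_eq => v /=; rewrite ?raddfD. Qed.
Fact op_pair_starM (x y : op_pair) :
  op_pair_star (x * y) = op_pair_star y * op_pair_star x.
Proof. by apply: op_pair_eq. Qed.
Fact op_pair_starZ (a : C) (x : op_pair) :
  op_pair_star (a *: x) = Num.conj a *: op_pair_star x.
Proof. by apply: op_pair_eq => v //=; rewrite conjCK. Qed.
HB.instance Definition _ := isStarAlgebra.Build C op_pair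
  op_pair_starK op_pair_starD op_pair_starM op_pair_starZ.

(** Elements are by construction values of formal words, hence the generators
    generate. *)
Lemma op_pair_ind (P : op_pair -> Prop) :
  star_subalgebra P -> (forall j, P (op_pair_gen j)) -> forall x, P x.
Proof.
move=> [P1 PD PZ PM _] Pgen x.
suff IH f g : opposite_words f g -> forall x, val x = (f, g) -> P x.
  by apply: (IH _ _ (op_pair_wordsP x)); case: (val x).
elim=> {f g x} [|j|f f' g g' hf IHf hg IHg|a f f' hf IHf
  |f f' g g' hf IHf hg IHg] x ex.
- by rewrite (_ : x = 1) //; apply: val_inj.
- by rewrite (_ : x = op_pair_gen j) //; apply: val_inj.
- rewrite (_ : x = make_op_pair hf + make_op_pair hg).
    by apply: PD; [apply: IHf | apply: IHg].
  by apply: val_inj.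
- rewrite (_ : x = a *: make_op_pair hf); first exact/PZ/IHf.
  by apply: val_inj.
- rewrite (_ : x = make_op_pair hf * make_op_pair hg).
    by apply: PM; [apply: IHf | apply: IHg].
  by apply: val_inj.
Qed.

(** A quadratic relation must be checked on the operators and on the reversed
    words; for the relations of interest the second check is an instance of
    the first. *)
Lemma op_pair_quadratic (K : finType) (c : K -> C) (s t : K -> J) (z : C) :
    (forall v, \sum_k c k *: op_act Q (s k) (op_act Q (t k) v) = z *: v) ->
    (forall v, \sum_k Num.conj (c k) *: op_act Q (t k) (op_act Q (s k) v)
       = Num.conj z *: v) ->
  \sum_k c k *: (op_pair_gen (s k) * op_pair_gen (t k)) = z%:A :> op_pair.
Proof.
move=> h1 h2; apply: op_pair_eq => v.
  rewrite -[RHS]/(z *: v) -h1 (big_morph (fun x : op_pair => (val x).1 v)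
    (op1 := +%R) (op2 := +%R) (id1 := 0) (id2 := 0)) //.
rewrite -[RHS]/(Num.conj z *: v) -h2 (big_morph (fun x : op_pair => (val x).2 v)
  (op1 := +%R) (op2 := +%R) (id1 := 0) (id2 := 0)) //.
Qed.

End StarAlgebraOfOperators.

(** * Hadamard matrices and conjugation by them *)

Lemma hadamard_conj (C : numClosedFieldType) N (H : 'M[C]_N) i j :
  hadamard H -> Num.conj (H i j) = H i j.
Proof. by case=> /(_ i j) [] -> _ _; rewrite ?rmorphN rmorph1. Qed.

Lemma hadamard_sqr (C : numClosedFieldType) N (H : 'M[C]_N) i j :
  hadamard H -> H i j * H i j = 1.
Proof. by case=> /(_ i j) [] -> _ _; rewrite ?mulrNN mulr1. Qed.

Lemma hadamard_row (C : numClosedFieldType) N (H : 'M[C]_N) a b :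
  hadamard H -> \sum_i H a i * H b i = N%:R * (a == b)%:R.
Proof.
case=> _ /matrixP/(_ a b) + _; rewrite !mxE mulr_natr => <-.
by apply: eq_bigr => i _; rewrite mxE.
Qed.

Lemma hadamard_col (C : numClosedFieldType) N (H : 'M[C]_N) i j :
  hadamard H -> \sum_a H a i * H a j = N%:R * (i == j)%:R.
Proof.
case=> _ _ /matrixP/(_ i j); rewrite !mxE mulr_natr => <-.
by apply: eq_bigr => a _; rewrite mxE.
Qed.

Lemma hadamard_invmx (C : numClosedFieldType) N (H : 'M[C]_N) :
  hadamard H -> invmx H = N%:R^-1 *: H^T.
Proof.
case: N H => [|N] H hH; first by apply/matrixP; case.
have HV : H *m (N.+1%:R^-1 *: H^T) = 1%:M.
  by case: hH => _ e _; rewrite -scalemxAr e scale_scalar_mx mulVf ?pnatr_eq0.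
have uH : H \in unitmx by case/mulmx1_unit: HV.
by rewrite -[RHS](mulKmx uH) HV mulmx1.
Qed.

(** [H' q H^-1] is orthogonal whenever [q] is, since [H] and [H'] are orthogonal
    up to a scalar.  Products of matrices over a noncommutative algebra are
    reversed by transposition only when one factor is scalar, which is the case
    at each step here. *)
Section Conjugate.
Variables (C : numClosedFieldType) (A : starAlgType C) (N : nat).
Variables (H H' : 'M[C]_N) (hH : hadamard H) (hH' : hadamard H').
Variable q : 'M[A]_N.

Definition conj_entry a b : A :=
  N%:R^-1 *: \sum_(s : 'I_N * 'I_N) (H' a s.1 * H b s.2) *: q s.1 s.2.

Lemma conj_entryE :
  to_alg A H' *m q *m to_alg A (invmx H) = \matrix_(a, b) conj_entry a b.
Proof.
apply/matrixP=> a b; rewrite !mxE /conj_entry.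
rewrite -(pair_bigA _ (fun i j => (H' a i * H b j) *: q i j)) exchange_big /=.
rewrite scaler_sumr; apply: eq_bigr => j _.
rewrite !mxE scaler_sumr mulr_suml; apply: eq_bigr => i _.
rewrite !mxE hadamard_invmx // !mxE -!scalerAl -scalerAr mulr1 mul1r !scalerA.
by congr (_ *: _); ring.
Qed.

Lemma conj_entryM a b c d :
  conj_entry a b * conj_entry c d = (N%:R^-1 * N%:R^-1) *:
    \sum_s \sum_t (H' a s.1 * H b s.2 * (H' c t.1 * H d t.2)) *:
      (q s.1 s.2 * q t.1 t.2).
Proof.
rewrite /conj_entry -scalerAl -scalerAr scalerA; congr (_ *: _).
rewrite mulr_suml; apply: eq_bigr => s _; rewrite mulr_sumr.
by apply: eq_bigr => t _; rewrite -scalerAl -scalerAr scalerA.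
Qed.

Lemma tr_to_algMl m n p (X : 'M[C]_(m, n)) (B : 'M[A]_(n, p)) :
  (to_alg A X *m B)^T = B^T *m to_alg A X^T.
Proof.
apply/matrixP=> i j; rewrite !mxE; apply: eq_bigr => k _.
by rewrite !mxE -scalerAl -scalerAr mul1r mulr1.
Qed.

Lemma tr_to_algMr m n p (B : 'M[A]_(m, n)) (X : 'M[C]_(n, p)) :
  (B *m to_alg A X)^T = to_alg A X^T *m B^T.
Proof.
apply/matrixP=> i j; rewrite !mxE; apply: eq_bigr => k _.
by rewrite !mxE -scalerAl -scalerAr mul1r mulr1.
Qed.

Lemma to_alg_scalarC m n (c : C) (B : 'M[A]_(m, n)) :
  B *m to_alg A c%:M = to_alg A c%:M *m B.
Proof.
have toE p : to_alg A (c%:M : 'M_p) = (c%:A)%:M by exact: map_scalar_mx.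
rewrite !toE mul_scalar_mx; apply/matrixP=> i j; rewrite !mxE (bigD1 j) //=.
rewrite big1 => [|k /negPf ne]; last by rewrite mxE ne mulr0n mulr0.
by rewrite mxE eqxx addr0 -scalerAl -scalerAr mul1r mulr1.
Qed.

Lemma conj_entry_star a b :
  (forall i j, star (q i j) = q i j) -> star (conj_entry a b) = conj_entry a b.
Proof.
move=> qs; have star0 : star (0 : A) = 0.
  by apply: (addrI (star (0 : A))); rewrite -starD !addr0.
rewrite /conj_entry starZ (big_morph _ starD star0).
rewrite fmorphV rmorph_nat; congr (_ *: _); apply: eq_bigr => s _.
by rewrite starZ qs rmorphM /= !hadamard_conj.
Qed.

Lemma conj_orthogonal : orthogonal_mx q ->
  orthogonal_mx (to_alg A H' *m q *m to_alg A (invmx H)).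
Proof.
case=> qs q1 q2; split.
- by move=> a b; rewrite conj_entryE mxE conj_entry_star.
- case: N H H' hH hH' q q1 q2 => [|n] K K' hK hK' r r1 r2.
    by apply/matrixP; case.
  rewrite tr_to_algMr tr_to_algMl hadamard_invmx // linearZ /= trmxK.
  rewrite !mulmxA -(mulmxA _ _ (to_alg A (_ *: K))) -map_mxM /=.
  case: hK => _ _; case: hK' => _ hK' _.
  rewrite -scalemxAl -scalemxAr scalerA => ->.
  rewrite scale_scalar_mx -mulrA mulVf ?pnatr_eq0 // mulr1 to_alg_scalarC.
  rewrite -!mulmxA (mulmxA r) r1 mul1mx -!map_mxM /= hK'.
  by rewrite mul_scalar_mx scale_scalar_mx mulVf ?pnatr_eq0 // map_mx1.
- case: N H H' hH hH' q q1 q2 => [|n] K K' hK hK' r r1 r2.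
    by apply/matrixP; case.
  rewrite tr_to_algMr tr_to_algMl hadamard_invmx // linearZ /= trmxK.
  rewrite !mulmxA -(mulmxA _ _ (to_alg A K')) -map_mxM /=.
  case: hK => _ hK _; case: hK' => _ _ ->.
  rewrite to_alg_scalarC !mulmxA -(mulmxA _ r^T r) r2 mulmx1 -!map_mxM /=.
  rewrite mul_scalar_mx -!scalemxAl -!scalemxAr hK !scalerA.
  by rewrite divff ?pnatr_eq0 // mul1r scale_scalar_mx mulVf ?pnatr_eq0 ?map_mx1.
Qed.
End Conjugate.

Section RelationsToIsomorphism.
Variables (C : numClosedFieldType) (N : nat) (H H' : 'M[C]_N).
Hypotheses (hH : hadamard H) (hH' : hadamard H').
Variable Q : operator_family C ('I_N * 'I_N).

Hypothesis rowQ : forall i k v,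
  \sum_j op_act Q (i, j) (op_act Q (k, j) v) = (i == k)%:R *: v.
Hypothesis colQ : forall j l v,
  \sum_i op_act Q (i, j) (op_act Q (i, l) v) = (j == l)%:R *: v.
Hypothesis row_annQ : forall i j k v,
  j != k -> op_act Q (i, j) (op_act Q (i, k) v) = 0.
Hypothesis col_annQ : forall i j k v,
  j != k -> op_act Q (j, i) (op_act Q (k, i) v) = 0.
Hypothesis conj_row_annQ : forall a b c v, b != c ->
  \sum_s \sum_t (H' a s.1 * H b s.2 * (H' a t.1 * H c t.2)) *:
    op_act Q s (op_act Q t v) = 0.
Hypothesis conj_col_annQ : forall a b c v, b != c ->
  \sum_s \sum_t (H' b s.1 * H a s.2 * (H' c t.1 * H a t.2)) *:
    op_act Q s (op_act Q t v) = 0.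

(** The generator pairs [(Q s, Q s)] are fixed by the star, and every relation
    read from right to left is again one of the relations. *)
Lemma quantum_isomorphic_of_operators : quantum_isomorphic H H'.
Proof.
pose A : starAlgType C := op_pair Q.
pose q : 'M[A]_N := \matrix_(i, j) op_pair_gen Q (i, j).
have q_orth : orthogonal_mx q.
  split=> [i j||]; first by rewrite mxE; apply: op_pair_eq.
  - apply/matrixP=> i k; rewrite !mxE.
    transitivity ((i == k)%:R%:A : A); last by rewrite scaler_nat.
    rewrite -(@op_pair_quadratic C _ Q 'I_N (fun=> 1) (pair i) (pair k)) => [|v|v].
    + by apply: eq_bigr => j _; rewrite !mxE scale1r.
    + by rewrite -rowQ; apply: eq_bigr => j _; rewrite scale1r.
    + rewrite rmorph_nat eq_sym -rowQ.
      by apply: eq_bigr => j _; rewrite rmorph1 scale1r.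
  - apply/matrixP=> j l; rewrite !mxE.
    transitivity ((j == l)%:R%:A : A); last by rewrite scaler_nat.
    rewrite -(@op_pair_quadratic C _ Q 'I_N (fun=> 1) (pair^~ j) (pair^~ l))
      => [|v|v].
    + by apply: eq_bigr => i _; rewrite !mxE scale1r.
    + by rewrite -colQ; apply: eq_bigr => i _; rewrite scale1r.
    + rewrite rmorph_nat eq_sym -colQ.
      by apply: eq_bigr => i _; rewrite rmorph1 scale1r.
exists A, q; split.
- split=> // i j k ne; rewrite !mxE; apply: op_pair_eq => v /=.
  + exact: row_annQ.
  + by apply: row_annQ; rewrite eq_sym.
  + exact: col_annQ.
  + by apply: col_annQ; rewrite eq_sym.
- move=> P hP Pq; apply: op_pair_ind => // -[i j].
  by have := Pq i j; rewrite mxE.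
- split; first exact: conj_orthogonal.
  + move=> a b c ne; rewrite conj_entryE // !mxE conj_entryM.
    rewrite (_ : \sum_s _ = 0) ?scaler0 //.
    under eq_bigr do under eq_bigr do rewrite !mxE -!surjective_pairing.
    rewrite pair_bigA /=.
    rewrite (@op_pair_quadratic C _ Q _
      (fun st : ('I_N * 'I_N) * ('I_N * 'I_N) => H' a st.1.1 * H b st.1.2 *
        (H' a st.2.1 * H c st.2.2)) fst snd 0) ?scale0r // => v.
      by rewrite scale0r -[RHS](conj_row_annQ a v ne) pair_bigA.
    rewrite rmorph0 scale0r.
    have ne' : c != b by rewrite eq_sym.
    rewrite -[RHS](conj_row_annQ a v ne') exchange_big pair_bigA /=.
    by apply: eq_bigr => st _; rewrite !rmorphM /= !hadamard_conj // mulrC.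
  + move=> a b c ne; rewrite conj_entryE // !mxE conj_entryM.
    rewrite (_ : \sum_s _ = 0) ?scaler0 //.
    under eq_bigr do under eq_bigr do rewrite !mxE -!surjective_pairing.
    rewrite pair_bigA /=.
    rewrite (@op_pair_quadratic C _ Q _
      (fun st : ('I_N * 'I_N) * ('I_N * 'I_N) => H' b st.1.1 * H a st.1.2 *
        (H' c st.2.1 * H a st.2.2)) fst snd 0) ?scale0r // => v.
      by rewrite scale0r -[RHS](conj_col_annQ a v ne) pair_bigA.
    rewrite rmorph0 scale0r.
    have ne' : c != b by rewrite eq_sym.
    rewrite -[RHS](conj_col_annQ a v ne') exchange_big pair_bigA /=.
    by apply: eq_bigr => st _; rewrite !rmorphM /= !hadamard_conj // mulrC.
Qed.
End RelationsToIsomorphism.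

Lemma sum_eq_mull (R : pzRingType) (I : finType) (F : I -> R) i :
  \sum_j (i == j)%:R * F j = F i.
Proof.
rewrite (bigD1 i) //= eqxx mul1r big1 ?addr0 // => j ne.
by rewrite eq_sym (negPf ne) mul0r.
Qed.

(** * The magic unitary of a Hadamard matrix and its tensor powers *)

Section Transfer.
Variables (R : fieldType) (I : finType).
Local Notation N := (#|I|%:R : R).
Hypothesis N_neq0 : N != 0.

(** The transpose of a Hadamard matrix: the first argument is the index of a
    letter, the second the index dual to it. *)
Record hadamard_kernel (K : I -> I -> R) : Prop := {
  kernel_sqr : forall x a, K x a * K x a = 1 ;
  kernel_row : forall x y, \sum_a K x a * K y a = N * (x == y)%:R ;
  kernel_col : forall a b, \sum_x K x a * K x b = N * (a == b)%:R
}.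

Section OneKernel.
Variables (K : I -> I -> R) (hK : hadamard_kernel K).

(** For fixed [x] and [y], the matrix of the projection on the line spanned by
    the vector with coordinates [K x b * K y b]. *)
Definition magic x y b a : R := N^-1 * (K x b * K x a * (K y b * K y a)).

Lemma magicC x y b a : magic x y b a = magic y x b a.
Proof. rewrite /magic; ring. Qed.

Lemma magic_transp x y b a : magic x y b a = magic x y a b.
Proof. rewrite /magic; ring. Qed.

Lemma magic_sum_col x b a : \sum_y magic x y b a = (b == a)%:R.
Proof.
rewrite /magic -mulr_sumr -mulr_sumr kernel_col // mulrCA mulKf //.
by case: eqP => [->|_]; rewrite ?mulr0 ?mulr1 ?kernel_sqr.
Qed.

Lemma magic_sum_row x y b : \sum_a magic x y b a = (x == y)%:R.
Proof.
transitivity (N^-1 * (K x b * K y b * \sum_a K x a * K y a)).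
  by rewrite !mulr_sumr; apply: eq_bigr => a _; rewrite /magic; ring.
rewrite kernel_row // mulrCA mulKf //.
by case: eqP => [->|_]; rewrite ?mulr0 ?mulr1 ?kernel_sqr.
Qed.

Lemma magic_sum_rowT x y a : \sum_b magic x y b a = (x == y)%:R.
Proof. by under eq_bigr do rewrite magic_transp; exact: magic_sum_row. Qed.

Lemma magic_mul x y z b c :
  \sum_a magic x y b a * magic x z a c = (y == z)%:R * magic x y b c.
Proof.
transitivity (N^-1 * N^-1 * (K x b * K x c * K y b * K z c *
    \sum_a K y a * K z a)).
  rewrite /magic !mulr_sumr; apply: eq_bigr => a _.
  by rewrite -[RHS]mulr1 -[X in _ = _ * X](kernel_sqr hK x a); field; rewrite N_neq0.
rewrite kernel_row // /magic; case: eqP => [->|_]; last by rewrite !mulr0 mul0r.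
by field; rewrite N_neq0.
Qed.

(** Composition along the letter index instead of the spin index: the pair of
    strands v meets two consecutive pairs of strands w whose inner spins agree
    on one side only if they agree on the other. *)
Lemma magic_dup x z b b' a :
  \sum_y magic x y b a * magic y z b' a = (b == b')%:R * magic x z b a.
Proof.
transitivity (N^-1 * N^-1 * (K x b * K x a * K z b' * K z a *
    \sum_y K y b * K y b')).
  rewrite /magic !mulr_sumr; apply: eq_bigr => y _.
  by rewrite -[RHS]mulr1 -[X in _ = _ * X](kernel_sqr hK y a); field; rewrite N_neq0.
rewrite kernel_col // /magic; case: eqP => [->|_]; last by rewrite !mulr0 mul0r.
by field; rewrite N_neq0.
Qed.

(** The spin between two strands v is [y] once they are to the left of all the
    strands w, and [x] before that; each step of the recursion crosses one pair
    of strands w, whose inner spin changes from [a] to [b]. *)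
Fixpoint transfer (y x : I) (f : seq I -> R) (bs : seq I) : R :=
  if bs is b :: bs' then
    \sum_a \sum_x' magic x x' b a * transfer y x' (fun s => f (a :: s)) bs'
  else (x == y)%:R * f [::].

Lemma transfer_sum (J : finType) y x (c : J -> R) (f : J -> seq I -> R) bs :
  transfer y x (fun s => \sum_j c j * f j s) bs =
  \sum_j c j * transfer y x (f j) bs.
Proof.
elim: bs x f => [|b bs IH] x f /=.
  by rewrite mulr_sumr; apply: eq_bigr => j _; rewrite mulrCA.
under [RHS]eq_bigr do rewrite mulr_sumr.
rewrite [RHS]exchange_big; apply: eq_bigr => a _ /=.
under [RHS]eq_bigr do rewrite mulr_sumr.
rewrite [RHS]exchange_big; apply: eq_bigr => x' _ /=.
by rewrite IH mulr_sumr; apply: eq_bigr => j _; rewrite mulrCA.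
Qed.

Lemma transferZ y x c f bs :
  transfer y x (fun s => c * f s) bs = c * transfer y x f bs.
Proof.
have := transfer_sum y x (fun _ : unit => c) (fun _ => f) bs.
by rewrite big_const card_unit /= addr0 => <-; congr transfer;
   apply: funext => s; rewrite big_const card_unit /= addr0.
Qed.

Lemma transfer_add (J : finType) y x (f : J -> seq I -> R) bs :
  \sum_j transfer y x (f j) bs = transfer y x (fun s => \sum_j f j s) bs.
Proof.
transitivity (\sum_j 1 * transfer y x (f j) bs).
  by apply: eq_bigr => j _; rewrite mul1r.
rewrite -transfer_sum; congr transfer; apply: funext => s.
by apply: eq_bigr => j _; rewrite mul1r.
Qed.

Lemma transfer0 y x bs : transfer y x (fun=> 0) bs = 0.
Proof. by rewrite -[RHS](mul0r (transfer y x (fun=> 0) bs)) -transferZ mul0r. Qed.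

Lemma transfer_sum2 (J J' : finType) y x (c : J -> J' -> R)
    (f : J -> J' -> seq I -> R) bs :
  transfer y x (fun s => \sum_j \sum_k c j k * f j k s) bs =
  \sum_j \sum_k c j k * transfer y x (f j k) bs.
Proof.
rewrite pair_bigA -(transfer_sum y x (fun p => c p.1 p.2)
  (fun p => f p.1 p.2)); congr transfer.
by apply: funext => s; rewrite pair_bigA.
Qed.

(** [transfer] is again a magic unitary, with operator entries: its rows and
    columns sum to the identity, and the entries of one row or of one column
    are orthogonal projections.  Each property is inherited from [magic] as in
    a tensor product. *)
Lemma sum_transfer_right y f bs : \sum_x transfer y x f bs = f bs.
Proof.
elim: bs f => [|b bs IH] f /=.
  by under eq_bigr do rewrite eq_sym; rewrite sum_eq_mull.
rewrite exchange_big /= -[RHS](sum_eq_mull (fun a => f (a :: bs))).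
apply: eq_bigr => a _.
rewrite exchange_big /= -(IH (fun s => f (a :: s))) mulr_sumr.
apply: eq_bigr => x' _.
rewrite -mulr_suml; congr (_ * _).
by under eq_bigr do rewrite magicC; rewrite magic_sum_col.
Qed.

Lemma sum_transfer_left x f bs : \sum_y transfer y x f bs = f bs.
Proof.
elim: bs x f => [|b bs IH] x f /=.
  exact: (sum_eq_mull (fun=> f [::])).
rewrite exchange_big /= -[RHS](sum_eq_mull (fun a => f (a :: bs))).
apply: eq_bigr => a _; rewrite exchange_big /= -(magic_sum_col x) mulr_suml.
by apply: eq_bigr => x' _; rewrite -mulr_sumr IH.
Qed.

Lemma transfer_cons2 y z x w f b bs :
  transfer z x (transfer y w f) (b :: bs) =
  \sum_c \sum_x' \sum_w' (\sum_a magic x x' b a * magic w w' a c) *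
    transfer z x' (transfer y w' (fun s => f (c :: s))) bs.
Proof.
rewrite /=; under eq_bigr do under eq_bigr do rewrite transfer_sum2 mulr_sumr.
under eq_bigr do rewrite exchange_big /=.
rewrite exchange_big /=; apply: eq_bigr => c _.
rewrite exchange_big /=; apply: eq_bigr => x' _.
under eq_bigr do rewrite mulr_sumr.
rewrite exchange_big /=; apply: eq_bigr => w' _.
by rewrite mulr_suml; apply: eq_bigr => a _; rewrite mulrA.
Qed.

Lemma transfer_left_orth y z x f bs :
  transfer z x (transfer y x f) bs = (z == y)%:R * transfer y x f bs.
Proof.
elim: bs x f => [|b bs IH] x f.
  rewrite /=; case: (eqVneq x y) => [->|_]; last by rewrite mul0r !mulr0.
  by rewrite mul1r eq_sym.
rewrite transfer_cons2 /= mulr_sumr; apply: eq_bigr => c _.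
rewrite mulr_sumr; apply: eq_bigr => x' _.
under eq_bigr do rewrite magic_mul // -mulrA.
by rewrite sum_eq_mull IH mulrCA.
Qed.

Lemma transfer_right_orth y x w f bs :
  transfer y x (transfer y w f) bs = (x == w)%:R * transfer y x f bs.
Proof.
elim: bs x w f => [|b bs IH] x w f.
  rewrite /=; case: (eqVneq x y) => [->|]; rewrite ?mul0r ?mulr0 // mul1r.
  by rewrite eq_sym mul1r.
rewrite transfer_cons2 /= mulr_sumr; apply: eq_bigr => c _.
rewrite mulr_sumr; apply: eq_bigr => x' _.
under eq_bigr do rewrite IH mulrCA.
rewrite sum_eq_mull mulrA; congr (_ * _).
under eq_bigr do rewrite (magicC x) (magicC w).
by rewrite magic_mul // magicC.
Qed.

End OneKernel.

(** * States of words and their pairing *)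

Definition state := seq I -> seq I -> R.

(** The two letters create one spin [b] between the new strands w, seen by both
    letters; then the new pair of strands v, with spin [j1] between them, is
    pulled to the left of the strands w created before, where its spin becomes
    [y].  The most recent letter comes first in all lists, and arguments of
    the wrong lengths get the value 0. *)
Definition push (K : I -> I -> R) (j2 j1 : I) (F : state) : state :=
  fun ys bs => match ys, bs with
  | y :: ys', b :: bs' => K j2 b * K j1 b * transfer K y j1 (F ys') bs'
  | _, _ => 0
  end.

Fixpoint pushes (K : I -> I -> R) (js : seq I) (F : state) : state :=
  if js is j2 :: j1 :: js' then push K j2 j1 (pushes K js' F) else F.

Lemma pushes_cat K u v F :
  ~~ odd (size u) -> pushes K (u ++ v) F = pushes K u (pushes K v F).
Proof.
have [m] := ubnP (size u); elim: m u => // m IH [|a [|b u]] //=.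
rewrite negbK => hm hu; rewrite IH //; exact: ltn_trans (ltnSn _) _.
Qed.

Definition cons_args (F : state) y b : state := fun ys bs => F (y :: ys) (b :: bs).

(** The factor [N^-1] per pair of letters is the normalisation for which
    contracting two neighbouring letters gives exactly a Kronecker symbol. *)
Fixpoint pairing (m : nat) (F' F : state) : R :=
  if m is m'.+1 then
    N^-1 * \sum_y \sum_b pairing m' (cons_args F' y b) (cons_args F y b)
  else F' [::] [::] * F [::] [::].

Lemma pairingC m F' F : pairing m F' F = pairing m F F'.
Proof.
elim: m F' F => [|m IH] F' F /=; first by rewrite mulrC.
by congr (_ * _); apply: eq_bigr => y _; apply: eq_bigr => b _.
Qed.

Lemma pairing_suml (J : finType) m (c : J -> R) (F' : J -> state) F :
  pairing m (fun ys bs => \sum_j c j * F' j ys bs) F =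
  \sum_j c j * pairing m (F' j) F.
Proof.
elim: m F' F => [|m IH] F' F /=.
  by rewrite mulr_suml; apply: eq_bigr => j _; rewrite mulrA.
under [RHS]eq_bigr do rewrite mulrCA.
rewrite -mulr_sumr; congr (_ * _).
under [RHS]eq_bigr do rewrite mulr_sumr.
rewrite [RHS]exchange_big; apply: eq_bigr => y _ /=.
under [RHS]eq_bigr do rewrite mulr_sumr.
by rewrite [RHS]exchange_big; apply: eq_bigr => b _ /=; rewrite -IH.
Qed.

Lemma pairing_sumr (J : finType) m (c : J -> R) F' (F : J -> state) :
  pairing m F' (fun ys bs => \sum_j c j * F j ys bs) =
  \sum_j c j * pairing m F' (F j).
Proof.
by rewrite pairingC pairing_suml; apply: eq_bigr => j _; rewrite pairingC.
Qed.

Lemma sum_unit (V : nmodType) (f : unit -> V) : \sum_j f j = f tt.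
Proof. by rewrite (bigD1 tt) //= big1 ?addr0 // => -[]. Qed.

Lemma pairingZl m c F' F :
  pairing m (fun ys bs => c * F' ys bs) F = c * pairing m F' F.
Proof.
have := pairing_suml m (fun _ : unit => c) (fun=> F') F.
rewrite sum_unit => <-; congr (pairing m _ F).
by apply: funext => ys; apply: funext => bs; rewrite sum_unit.
Qed.

Lemma pairingZr m c F' F :
  pairing m F' (fun ys bs => c * F ys bs) = c * pairing m F' F.
Proof. by rewrite pairingC pairingZl pairingC. Qed.

(** Linearity, in a form which also pulls the operator through the sums that
    define [transfer]. *)
Definition sum_linear (T : state -> state) : Prop :=
  forall (J : finType) (c : J -> R) (F : J -> state) ys bs,
    T (fun ys bs => \sum_j c j * F j ys bs) ys bs = \sum_j c j * T (F j) ys bs.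

Definition commutes_transfer (K : I -> I -> R) (T : state -> state) : Prop :=
  forall y x F ys bs,
    T (fun ys => transfer K y x (F ys)) ys bs = transfer K y x (T F ys) bs.

(** The same operator one pair of letters earlier: it leaves the two most
    recent spins alone. *)
Definition lift_op (T : state -> state) : state -> state :=
  fun F ys bs => match ys, bs with
  | y :: ys', b :: bs' => T (cons_args F y b) ys' bs'
  | _, _ => 0
  end.

Lemma sum_linearZ T c F ys bs : sum_linear T ->
  T (fun ys bs => c * F ys bs) ys bs = c * T F ys bs.
Proof.
move=> /(_ unit (fun=> c) (fun=> F) ys bs); rewrite sum_unit => <-.
congr (T _ ys bs).
by apply: funext => us; apply: funext => vs; rewrite sum_unit.
Qed.

Lemma sum_linear_lift T : sum_linear T -> sum_linear (lift_op T).
Proof.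
move=> hT J c F [|y ys] [|b bs] /=; rewrite -?hT //;
  by rewrite big1 // => j _; rewrite mulr0.
Qed.

Lemma commutes_transfer_lift K T : sum_linear T -> commutes_transfer K T ->
  commutes_transfer K (lift_op T).
Proof.
move=> lT hT y x F [|y' ys] [|b bs] //=; rewrite ?transfer0 ?mulr0 //.
  under [RHS]eq_bigr do under eq_bigr do rewrite transfer0 mulr0.
  by rewrite big1 // => a _; rewrite big1.
under [RHS]eq_bigr do under eq_bigr do rewrite -hT.
rewrite pair_bigA -(lT _ (fun p => magic K x p.2 b p.1)
  (fun p us vs => transfer K y p.2 (cons_args F y' p.1 us) vs)).
by congr (T _ ys bs); apply: funext => us; apply: funext => vs;
  rewrite /cons_args /= pair_bigA.
Qed.

(** An operator commuting with [transfer] survives the addition of two letters;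
    only its position among the spins changes. *)
Lemma push_lift K T j2 j1 F : sum_linear T -> commutes_transfer K T ->
  push K j2 j1 (T F) = lift_op T (push K j2 j1 F).
Proof.
move=> lT hT; apply: funext => -[|y ys]; apply: funext => -[|b bs] //=.
by rewrite -hT -sum_linearZ.
Qed.

(** Operators that can be moved from the first argument of the pairing, where
    words are evaluated with [K'], to the second, where they are evaluated with
    [K], even after more letters have been added. *)
Record sliding (K' K : I -> I -> R) (m m' : nat) (T T' : state -> state) :
    Prop := {
  sliding_linl : sum_linear T ;
  sliding_linr : sum_linear T' ;
  sliding_coml : commutes_transfer K' T ;
  sliding_comr : commutes_transfer K T' ;
  sliding_adj : forall F' F, pairing m' (T F') F = pairing m F' (T' F)
}.

Lemma sliding_lift K' K m m' T T' : sliding K' K m m' T T' ->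
  sliding K' K m.+1 m'.+1 (lift_op T) (lift_op T').
Proof.
case=> l1 l2 c1 c2 adj; split.
- exact: sum_linear_lift.
- exact: sum_linear_lift.
- exact: commutes_transfer_lift.
- exact: commutes_transfer_lift.
- move=> F' F /=; congr (_ * _).
  by apply: eq_bigr => y _; apply: eq_bigr => b _; apply: adj.
Qed.

Lemma sliding_comp K' K m m' m'' T T' S S' :
  sliding K' K m m' T T' -> sliding K' K m' m'' S S' ->
  sliding K' K m m'' (S \o T) (T' \o S').
Proof.
case=> l1 l2 c1 c2 adj [l1' l2' c1' c2' adj']; split.
- move=> J c F ys bs /=; rewrite -l1'; congr (S _ ys bs).
  by apply: funext => us; apply: funext => vs; rewrite l1.
- move=> J c F ys bs /=; rewrite -l2; congr (T' _ ys bs).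
  by apply: funext => us; apply: funext => vs; rewrite l2'.
- move=> y x F ys bs /=; rewrite -c1'; congr (S _ ys bs).
  by apply: funext => us; apply: funext => vs; rewrite c1.
- move=> y x F ys bs /=; rewrite -c2; congr (T' _ ys bs).
  by apply: funext => us; apply: funext => vs; rewrite c2'.
- by move=> F' F /=; rewrite adj' adj.
Qed.

(** By [push_lift], the operator becomes an iterated lift acting after all the
    later letters; there it is transposed, and then it is brought back. *)
Lemma pairing_slide K' K m m' T T' l u' u F' F : sliding K' K m m' T T' ->
  size u' = l.*2 -> size u = l.*2 ->
  pairing (l + m') (pushes K' u' (T F')) (pushes K u F) =
  pairing (l + m) (pushes K' u' F') (pushes K u (T' F)).
Proof.
move=> hT su' su.
suff [S [S' [[_ _ _ _ adj] eS]]] : exists S S', sliding K' K (l + m) (l + m') S S' /\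
    (forall v, size v = l.*2 ->
       (forall G, pushes K' v (T G) = S (pushes K' v G)) /\
       (forall G, pushes K v (T' G) = S' (pushes K v G))).
  by rewrite (eS _ su').1 (eS _ su).2 adj.
elim: l {u u' su su'} => [|l [S [S' [hS eS]]]].
  by exists T, T'; split=> // -[].
exists (lift_op S), (lift_op S'); split.
  by rewrite !addSn; exact: sliding_lift.
case: hS => l1 l2 c1 c2 _ [|a [|b v]] //= [sv].
by split=> G; rewrite ((eS _ sv).1, (eS _ sv).2) push_lift.
Qed.

(** * The operators that encode the relations *)

Definition avg_v (F : state) : state := fun ys bs =>
  if ys is _ :: ys' then N^-1 * \sum_y F (y :: ys') bs else 0.
Definition dup_v (F : state) : state := fun ys bs =>
  if ys is y :: y' :: _ then (y == y')%:R * F ys bs else 0.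
Definition avg_w (F : state) : state := fun ys bs =>
  if bs is _ :: bs' then N^-1 * \sum_b F ys (b :: bs') else 0.
Definition dup_w (F : state) : state := fun ys bs =>
  if bs is b :: b' :: _ then (b == b')%:R * F ys bs else 0.
(** [cup] inserts a pair of letters that have been contracted with each other;
    [cap] is its transpose for the pairing. *)
Definition cup (F : state) : state := fun ys bs =>
  match ys, bs with _ :: ys', _ :: bs' => F ys' bs' | _, _ => 0 end.
Definition cap (F : state) : state := fun ys bs =>
  N^-1 * \sum_y \sum_b F (y :: ys) (b :: bs).

Section Naturality.
Variables (K : I -> I -> R) (hK : hadamard_kernel K).

(** Both sides vanish unless both pairs of spins agree; this is what lets
    [dup_w] pass through a transfer. *)
Lemma magic_dup_shift x z b b' a a' :
  (b == b')%:R * (\sum_y magic K x y b a * magic K y z b' a') =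
  (a == a')%:R * (\sum_y magic K x y b a * magic K y z b' a').
Proof.
case: (eqVneq b b') => [<-|neb]; case: (eqVneq a a') => [<-|nea] //.
  rewrite mul1r mul0r; under eq_bigr do rewrite magic_transp (magic_transp _ _ _ b).
  by rewrite magic_dup // (negPf nea) mul0r.
by rewrite mul1r mul0r magic_dup // (negPf neb) mul0r.
Qed.

Lemma transfer_cons_cons y x f b b' bs : transfer K y x f (b :: b' :: bs) =
  \sum_a \sum_a' \sum_z (\sum_w magic K x w b a * magic K w z b' a') *
    transfer K y z (fun s => f (a :: a' :: s)) bs.
Proof.
rewrite /=; apply: eq_bigr => a _.
under eq_bigr do rewrite mulr_sumr.
rewrite exchange_big /=; apply: eq_bigr => a' _.
under eq_bigr do rewrite mulr_sumr.
rewrite exchange_big /=; apply: eq_bigr => z _.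
by rewrite mulr_suml; apply: eq_bigr => w _; rewrite mulrA.
Qed.

Lemma avg_v_transfer : commutes_transfer K avg_v.
Proof.
move=> y x F [|y' ys] bs /=; first by rewrite transfer0.
rewrite transferZ; congr (_ * _); rewrite -transfer_add //.
Qed.

Lemma dup_v_transfer : commutes_transfer K dup_v.
Proof.
by move=> y x F [|y' [|y'' ys]] bs /=; rewrite ?transfer0 ?transferZ.
Qed.

Lemma avg_w_transfer : commutes_transfer K avg_w.
Proof.
move=> y x F ys [|b bs] /=; first by rewrite mulr0.
rewrite exchange_big /= mulr_sumr exchange_big /=.
under [RHS]eq_bigr do rewrite -mulr_suml magic_sum_row //.
rewrite sum_eq_mull transferZ -mulr_sumr -transfer_add; congr (_ * _).
apply: eq_bigr => a _; rewrite exchange_big /=.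
under eq_bigr do rewrite -mulr_suml magic_sum_rowT //.
by rewrite sum_eq_mull.
Qed.

Lemma dup_w_transfer : commutes_transfer K dup_w.
Proof.
move=> y x F ys [|b [|b' bs]]; first by rewrite /= mulr0.
  by rewrite /= big1 // => a _; rewrite big1 // => x' _; rewrite !mulr0.
rewrite [LHS]/= -/(transfer K y x (F ys) (b :: b' :: bs)) !transfer_cons_cons.
rewrite mulr_sumr; apply: eq_bigr => a _; rewrite mulr_sumr.
apply: eq_bigr => a' _; rewrite mulr_sumr; apply: eq_bigr => z _.
by rewrite mulrA magic_dup_shift transferZ; ring.
Qed.

Lemma cup_transfer : commutes_transfer K cup.
Proof.
move=> y x F [|y' ys] [|b bs] //=; rewrite ?mulr0 //.
  by rewrite big1 // => a _; rewrite big1 // => x' _; rewrite transfer0 mulr0.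
rewrite exchange_big /=.
under eq_bigr do rewrite -mulr_suml magic_sum_row //.
by rewrite sum_eq_mull.
Qed.

Lemma cap_transfer : commutes_transfer K cap.
Proof.
move=> y x F ys bs /=; rewrite transferZ -transfer_add; congr (_ * _).
apply: eq_bigr => y' _; rewrite -transfer_add exchange_big /=.
apply: eq_bigr => a _; rewrite exchange_big /=.
under eq_bigr do rewrite -mulr_suml magic_sum_rowT //.
by rewrite sum_eq_mull.
Qed.

End Naturality.

Lemma avg_v_linear : sum_linear avg_v.
Proof.
move=> J c F [|y ys] bs /=; first by rewrite big1 // => j _; rewrite mulr0.
rewrite exchange_big mulr_sumr; apply: eq_bigr => j _ /=.
by rewrite -mulr_sumr mulrCA.
Qed.

Lemma dup_v_linear : sum_linear dup_v.
Proof.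
move=> J c F [|y [|y' ys]] bs /=; try by rewrite big1 // => j _; rewrite mulr0.
by rewrite mulr_sumr; apply: eq_bigr => j _; rewrite mulrCA.
Qed.

Lemma avg_w_linear : sum_linear avg_w.
Proof.
move=> J c F ys [|b bs] /=; first by rewrite big1 // => j _; rewrite mulr0.
rewrite exchange_big mulr_sumr; apply: eq_bigr => j _ /=.
by rewrite -mulr_sumr mulrCA.
Qed.

Lemma dup_w_linear : sum_linear dup_w.
Proof.
move=> J c F ys [|b [|b' bs]] /=; try by rewrite big1 // => j _; rewrite mulr0.
by rewrite mulr_sumr; apply: eq_bigr => j _; rewrite mulrCA.
Qed.

Lemma cup_linear : sum_linear cup.
Proof.
by move=> J c F [|y ys] [|b bs] //=; rewrite big1 // => j _; rewrite mulr0.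
Qed.

Lemma cap_linear : sum_linear cap.
Proof.
move=> J c F ys bs; rewrite /cap; under eq_bigr do rewrite exchange_big /=.
rewrite exchange_big mulr_sumr; apply: eq_bigr => j _ /=.
rewrite mulrCA; congr (_ * _); rewrite mulr_sumr; apply: eq_bigr => y _.
by rewrite -mulr_sumr.
Qed.

Lemma pairing_suml1 (J : finType) m (F' : J -> state) F :
  pairing m (fun ys bs => \sum_j F' j ys bs) F = \sum_j pairing m (F' j) F.
Proof.
transitivity (\sum_j 1 * pairing m (F' j) F); last first.
  by apply: eq_bigr => j _; rewrite mul1r.
rewrite -pairing_suml; congr (pairing m _ F).
apply: funext => ys; apply: funext => bs.
by apply: eq_bigr => j _; rewrite mul1r.
Qed.

Lemma pairing_sumr1 (J : finType) m F' (F : J -> state) :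
  pairing m F' (fun ys bs => \sum_j F j ys bs) = \sum_j pairing m F' (F j).
Proof.
by rewrite pairingC pairing_suml1; apply: eq_bigr => j _; rewrite pairingC.
Qed.

(** The averaging and duplication operators are symmetric for the pairing. *)
Lemma pairing_avg_v m F' F : pairing m.+1 (avg_v F') F = pairing m.+1 F' (avg_v F).
Proof.
rewrite /=; congr (_ * _); rewrite exchange_big [RHS]exchange_big.
apply: eq_bigr => b _ /=.
have avgE G y : cons_args (avg_v G) y b =
    fun ys bs => N^-1 * \sum_y' cons_args G y' b ys bs by [].
under eq_bigr do rewrite avgE pairingZl pairing_suml1.
under [RHS]eq_bigr do rewrite avgE pairingZr pairing_sumr1.
by rewrite -!mulr_sumr exchange_big.
Qed.

Lemma pairing_avg_w m F' F : pairing m.+1 (avg_w F') F = pairing m.+1 F' (avg_w F).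
Proof.
rewrite /=; congr (_ * _); apply: eq_bigr => y _ /=.
have avgE G b : cons_args (avg_w G) y b =
    fun ys bs => N^-1 * \sum_b' cons_args G y b' ys bs by [].
under eq_bigr do rewrite avgE pairingZl pairing_suml1.
under [RHS]eq_bigr do rewrite avgE pairingZr pairing_sumr1.
by rewrite -!mulr_sumr exchange_big.
Qed.

Lemma pairing_dup_v m F' F : pairing m.+2 (dup_v F') F = pairing m.+2 F' (dup_v F).
Proof.
rewrite /=; congr (_ * _); apply: eq_bigr => y _; apply: eq_bigr => b _.
congr (_ * _); apply: eq_bigr => y' _; apply: eq_bigr => b' _.
have dupE G : cons_args (cons_args (dup_v G) y b) y' b' =
  fun ys bs => (y == y')%:R * cons_args (cons_args G y b) y' b' ys bs by [].
by rewrite !dupE pairingZl pairingZr.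
Qed.

Lemma pairing_dup_w m F' F : pairing m.+2 (dup_w F') F = pairing m.+2 F' (dup_w F).
Proof.
rewrite /=; congr (_ * _); apply: eq_bigr => y _; apply: eq_bigr => b _.
congr (_ * _); apply: eq_bigr => y' _; apply: eq_bigr => b' _.
have dupE G : cons_args (cons_args (dup_w G) y b) y' b' =
  fun ys bs => (b == b')%:R * cons_args (cons_args G y b) y' b' ys bs by [].
by rewrite !dupE pairingZl pairingZr.
Qed.

Lemma pairing_cup m F' F : pairing m.+1 (cup F') F = pairing m F' (cap F).
Proof.
rewrite pairingZr /=; congr (_ * _); rewrite pairing_sumr1.
by apply: eq_bigr => y _; rewrite pairing_sumr1.
Qed.

Section TwoKernels.
Variables (K' K : I -> I -> R).
Hypotheses (hK' : hadamard_kernel K') (hK : hadamard_kernel K).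

Lemma sliding_avg_v m : sliding K' K m.+1 m.+1 avg_v avg_v.
Proof.
split; [exact: avg_v_linear.. | exact: avg_v_transfer | exact: avg_v_transfer|].
exact: pairing_avg_v.
Qed.

Lemma sliding_avg_w m : sliding K' K m.+1 m.+1 avg_w avg_w.
Proof.
split; [exact: avg_w_linear.. | exact: avg_w_transfer |
  exact: avg_w_transfer | exact: pairing_avg_w].
Qed.

Lemma sliding_dup_v m : sliding K' K m.+2 m.+2 dup_v dup_v.
Proof.
split; [exact: dup_v_linear.. | exact: dup_v_transfer |
  exact: dup_v_transfer | exact: pairing_dup_v].
Qed.

Lemma sliding_dup_w m : sliding K' K m.+2 m.+2 dup_w dup_w.
Proof.
split; [exact: dup_w_linear.. | exact: dup_w_transfer |
  exact: dup_w_transfer | exact: pairing_dup_w].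
Qed.

Lemma sliding_cup m : sliding K' K m m.+1 cup cap.
Proof.
split; [exact: cup_linear | exact: cap_linear | exact: cup_transfer |
  exact: cap_transfer | exact: pairing_cup].
Qed.

End TwoKernels.

(** * Relations between the two most recent letters *)

Section LastLetters.
Variables (K : I -> I -> R) (hK : hadamard_kernel K).

(** Two letters pushed together share the spin [b] through the product of two
    rows of [K]; averaging it away leaves the scalar product of these rows. *)
Lemma avg_w_push j2 j1 F : avg_w (push K j2 j1 F) =
  fun ys bs => (j2 == j1)%:R * push K j2 j1 F ys bs.
Proof.
apply: funext => -[|y ys]; apply: funext => -[|b bs] /=; rewrite ?mulr0 //.
  by rewrite big1 ?mulr0.
rewrite -mulr_suml kernel_row // !mulrA mulVf // mul1r; congr (_ * _).
by case: eqP => [->|_]; rewrite ?mul0r // mul1r kernel_sqr.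
Qed.

(** If the two letters agree, the weights are squares of signs, and summing over
    the common letter sums a row of the magic unitary [transfer]. *)
Lemma sum_push_cup F :
  (fun ys bs => \sum_j push K j j F ys bs) = cup F.
Proof.
apply: funext => -[|y ys]; apply: funext => -[|b bs] /=; rewrite ?big1_eq //.
by under eq_bigr do rewrite kernel_sqr // mul1r; rewrite sum_transfer_right.
Qed.

Lemma cap_push j2 j1 F : cap (push K j2 j1 F) =
  fun ys bs => (j2 == j1)%:R * F ys bs.
Proof.
apply: funext => ys; apply: funext => bs; rewrite /cap /=.
rewrite exchange_big /=; under eq_bigr do rewrite -mulr_sumr sum_transfer_left //.
by rewrite -mulr_suml kernel_row // !mulrA mulVf // mul1r.
Qed.

(** The two letters expressed in the basis formed by the columns of [K]. *)
Definition conj_push b c F : state := fun ys bs =>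
  \sum_j2 \sum_j1 K j2 b * K j1 c * push K j2 j1 F ys bs.

(** Expanding the more recent letter forces the new spin to be [b]; averaging
    over [y] then removes the transfer, and the scalar product of the columns
    [b] and [c] remains. *)
Lemma avg_v_conj_push b c F : avg_v (conj_push b c F) =
  fun ys bs => (b == c)%:R * conj_push b c F ys bs.
Proof.
apply: funext => -[|y ys]; apply: funext => -[|d bs];
  rewrite /avg_v /conj_push.
- by rewrite big1 ?mulr0 // => j2 _; rewrite big1 // => j1 _; rewrite mulr0.
- by rewrite big1 ?mulr0 // => j2 _; rewrite big1 // => j1 _; rewrite mulr0.
- rewrite [in RHS]big1 => [|j2 _]; last by rewrite big1 // => j1 _; rewrite mulr0.
  rewrite big1 ?mulr0 // => y' _.
  by rewrite big1 // => j2 _; rewrite big1 // => j1 _; rewrite mulr0.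
have E y' : \sum_j2 \sum_j1 K j2 b * K j1 c * push K j2 j1 F (y' :: ys) (d :: bs)
    = N * (b == d)%:R * \sum_j1 K j1 c * K j1 d * transfer K y' j1 (F ys) bs.
  rewrite -(kernel_col hK) mulr_suml; apply: eq_bigr => j2 _.
  by rewrite mulr_sumr; apply: eq_bigr => j1 _ /=; ring.
under eq_bigr do rewrite E.
rewrite E -mulr_sumr exchange_big /=.
under [in LHS]eq_bigr do rewrite -mulr_sumr sum_transfer_left //.
rewrite -mulr_suml kernel_col //.
case: (eqVneq b d) => [<-|_]; last by rewrite !(mulr0, mul0r).
rewrite eq_sym; case: eqP => [<-|_]; last by rewrite !(mulr0, mul0r).
under [in RHS]eq_bigr do rewrite kernel_sqr // mul1r.
by rewrite sum_transfer_right //; field.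
Qed.

(** Letters [j3] and [j2] are neighbours belonging to different pushed pairs.
    The weight attached to [j2] contains the spin [a] over which the transfer
    of [j3] sums, and this sum is what makes the two letters interact. *)
Lemma push2E j4 j3 j2 j1 F y2 y1 ys b2 b1 bs :
  push K j4 j3 (push K j2 j1 F) (y2 :: y1 :: ys) (b2 :: b1 :: bs) =
  K j4 b2 * K j3 b2 * \sum_a \sum_x magic K j3 x b1 a * (K j2 a * K j1 a *
    transfer K y2 x (transfer K y1 j1 (F ys)) bs).
Proof.
rewrite /=; congr (_ * _); apply: eq_bigr => a _; apply: eq_bigr => x _.
by rewrite transferZ.
Qed.

Lemma push2_short j4 j3 j2 j1 F ys bs : (size ys < 2)%N || (size bs < 2)%N ->
  push K j4 j3 (push K j2 j1 F) ys bs = 0.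
Proof.
case: ys => [|y [|y' ys]] //; case: bs => [|b [|b' bs]] //= _;
  rewrite ?mulr0 // ?transfer0 ?mulr0 //.
by rewrite big1 ?mulr0 // => a _; rewrite big1 // => x _; rewrite transfer0 mulr0.
Qed.

(** If the spins of the two pairs of strands v agree, orthogonality of the
    entries of [transfer] forces the inner letter [x] to be [j1], and the sum
    over [a] then compares [j3] with [j2]. *)
Lemma push2_dup_v j4 j3 j2 j1 F y2 y1 ys b2 b1 bs :
  (y2 == y1)%:R *
    push K j4 j3 (push K j2 j1 F) (y2 :: y1 :: ys) (b2 :: b1 :: bs) =
  (y2 == y1)%:R * (j3 == j2)%:R * (K j4 b2 * K j3 b2 * (K j3 b1 * K j1 b1)) *
    transfer K y1 j1 (F ys) bs.
Proof.
rewrite push2E; case: eqP => [->|_]; last by rewrite !mul0r.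
rewrite !mul1r exchange_big /=.
under eq_bigr do under eq_bigr do rewrite transfer_right_orth // eq_sym.
transitivity (K j4 b2 * K j3 b2 * \sum_x (j1 == x)%:R * 
  ((\sum_a magic K j3 x b1 a * (K j2 a * K j1 a)) * transfer K y1 x (F ys) bs)).
  congr (_ * _); apply: eq_bigr => x _; rewrite mulr_suml mulr_sumr.
  by apply: eq_bigr => a _; ring.
rewrite sum_eq_mull.
have -> : \sum_a magic K j3 j1 b1 a * (K j2 a * K j1 a) =
    N^-1 * (K j3 b1 * K j1 b1 * \sum_a K j3 a * K j2 a).
  rewrite !mulr_sumr; apply: eq_bigr => a _; rewrite /magic.
  by rewrite -[RHS]mulr1 -[X in _ = _ * X](kernel_sqr hK j1 a); ring.
by rewrite kernel_row //; case: eqP => [->|_]; field.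
Qed.

(** If the two letters agree, the sum over [a] forces [x] to be [j1], and
    orthogonality of the entries of [transfer] then compares the spins. *)
Lemma push2_diag j4 j3 j1 F y2 y1 ys b2 b1 bs :
    push K j4 j3 (push K j3 j1 F) (y2 :: y1 :: ys) (b2 :: b1 :: bs) =
  (y2 == y1)%:R * (K j4 b2 * K j3 b2 * (K j3 b1 * K j1 b1)) *
    transfer K y1 j1 (F ys) bs.
Proof.
rewrite push2E exchange_big /=.
transitivity (K j4 b2 * K j3 b2 * \sum_x (K j3 b1 * K x b1 * (N^-1 *
    \sum_a K x a * K j1 a)) * transfer K y2 x (transfer K y1 j1 (F ys)) bs).
  congr (_ * _); apply: eq_bigr => x _; rewrite !(mulr_sumr, mulr_suml).
  apply: eq_bigr => a _; rewrite /magic.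
  by rewrite -[RHS]mulr1 -[X in _ = _ * X](kernel_sqr hK j3 a); ring.
under eq_bigr do rewrite kernel_row // mulKf // (eq_sym _ j1) -mulrA mulrCA.
by rewrite sum_eq_mull transfer_left_orth //; ring.
Qed.

(** Neighbouring letters in different pairs agree exactly when the spins of
    their pairs of strands v do: both [push2_dup_v] and [push2_diag] give the
    same value. *)
Lemma dup_v_push2 j4 j3 j2 j1 F : dup_v (push K j4 j3 (push K j2 j1 F)) =
  fun ys bs => (j3 == j2)%:R * push K j4 j3 (push K j2 j1 F) ys bs.
Proof.
apply: funext => ys; apply: funext => bs.
case: (boolP ((size ys < 2) || (size bs < 2))%N) => [short|].
  rewrite [in RHS]push2_short // mulr0.
  by case: ys short => [|y [|y' ys]] // short; rewrite /dup_v push2_short ?mulr0.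
case: ys bs => [|y2 [|y1 ys]] [|b2 [|b1 bs]] // _.
rewrite -[LHS]/((y2 == y1)%:R *
  push K j4 j3 (push K j2 j1 F) (y2 :: y1 :: ys) (b2 :: b1 :: bs)) push2_dup_v.
case: (eqVneq j3 j2) => [->|_]; last by rewrite !(mul0r, mulr0).
by rewrite push2_diag; ring.
Qed.

Lemma sum_push2_cup j4 j1 F :
  (fun ys bs => \sum_j push K j4 j (push K j j1 F) ys bs) =
  fun ys bs => N * dup_v (dup_w (cup (push K j4 j1 F))) ys bs.
Proof.
apply: funext => ys; apply: funext => bs.
case: (boolP ((size ys < 2) || (size bs < 2))%N) => [short|].
  rewrite big1 => [|j _]; last exact: push2_short.
  by case: ys bs short => [|y [|y' ys]] [|b [|b' bs]] //= _; rewrite ?mulr0.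
case: ys bs => [|y2 [|y1 ys]] [|b2 [|b1 bs]] // _.
under eq_bigr do rewrite push2_diag.
transitivity ((y2 == y1)%:R * K j4 b2 * K j1 b1 * (\sum_j K j b2 * K j b1) *
  transfer K y1 j1 (F ys) bs).
  by rewrite mulr_sumr mulr_suml; apply: eq_bigr => j _; ring.
by rewrite kernel_col //=; case: (eqVneq b2 b1) => [->|_];
  rewrite !(mul1r, mulr1, mul0r, mulr0) //; ring.
Qed.

Lemma cap_dup_push2 j4 j3 j2 j1 F :
  cap (dup_w (dup_v (push K j4 j3 (push K j2 j1 F)))) =
  fun ys bs => N^-1 * ((j3 == j2)%:R * push K j4 j1 F ys bs).
Proof.
rewrite dup_v_push2; case: eqP => [<-|_]; last first.
  apply: funext => ys; apply: funext => bs; rewrite mul0r mulr0 /cap.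
  rewrite big1 ?mulr0 // => y _; rewrite big1 // => b _.
  by case: bs => //= b' bs; rewrite mul0r mulr0.
apply: funext => ys; apply: funext => bs; rewrite /cap mul1r; congr (_ * _).
case: bs => [|b1 bs].
  by case: ys => [|y1 ys]; rewrite big1 // => y _; rewrite big1.
case: ys => [|y1 ys].
  rewrite big1 // => y _; rewrite big1 // => b _.
  by rewrite /dup_w push2_short // !mulr0.
transitivity (\sum_y (y1 == y)%:R * (\sum_b (b1 == b)%:R * 
    (K j4 b * K j1 b1 * (K j3 b * K j3 b1) * transfer K y1 j1 (F ys) bs))).
  apply: eq_bigr => y _; rewrite mulr_sumr; apply: eq_bigr => b _.
  rewrite -[LHS]/((b == b1)%:R * (1 * push K j4 j3 (push K j3 j1 F)
    (y :: y1 :: ys) (b :: b1 :: bs))).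
  by rewrite push2_diag (eq_sym y) (eq_sym b); ring.
by rewrite sum_eq_mull sum_eq_mull kernel_sqr // mulr1.
Qed.

Definition conj_push2 b c j4 j1 F : state := fun ys bs =>
  \sum_j3 \sum_j2 K j3 b * K j2 c * push K j4 j3 (push K j2 j1 F) ys bs.

(** The sum over the letter [j3] is the sum [S] of a product of four entries of
    one row; it reduces to a scalar product of two columns both when the spins
    [b2] and [b1] agree and when [b] and [c] do. *)
Lemma dup_w_conj_push2 b c j4 j1 F : dup_w (conj_push2 b c j4 j1 F) =
  fun ys bs => (b == c)%:R * conj_push2 b c j4 j1 F ys bs.
Proof.
apply: funext => ys; apply: funext => bs.
case: (boolP ((size ys < 2) || (size bs < 2))%N) => [short|].
  have e : conj_push2 b c j4 j1 F ys bs = 0.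
    rewrite /conj_push2 big1 // => j3 _; rewrite big1 // => j2 _.
    by rewrite push2_short ?mulr0.
  by case: bs short e => [|b2 [|b1 bs]] /= _ ->; rewrite !mulr0.
case: ys bs => [|y2 [|y1 ys]] [|b2 [|b1 bs]] // _.
rewrite -[LHS]/((b2 == b1)%:R *
  conj_push2 b c j4 j1 F (y2 :: y1 :: ys) (b2 :: b1 :: bs)).
pose S := \sum_j K j b * K j b2 * (K j b1 * K j c).
pose Z := \sum_x K x b1 * K x c *
  (transfer K y2 x (transfer K y1 j1 (F ys)) bs).
have -> : conj_push2 b c j4 j1 F (y2 :: y1 :: ys) (b2 :: b1 :: bs) =
    S * (K j4 b2 * K j1 c * Z).
  rewrite /conj_push2 /S mulr_suml; apply: eq_bigr => j3 _.
  under eq_bigr do rewrite push2E.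
  transitivity (K j3 b * K j4 b2 * K j3 b2 * \sum_a \sum_x
    (magic K j3 x b1 a * (K j1 a * transfer K y2 x (transfer K y1 j1 (F ys)) bs) *
     \sum_j2 K j2 c * K j2 a)).
    rewrite mulr_sumr.
    under [RHS]eq_bigr do rewrite mulr_sumr.
    under [RHS]eq_bigr do under eq_bigr do rewrite mulr_sumr mulr_sumr.
    under [RHS]eq_bigr do rewrite exchange_big.
    rewrite [RHS]exchange_big; apply: eq_bigr => j2 _ /=.
    rewrite !mulr_sumr; apply: eq_bigr => a _.
    by rewrite !mulr_sumr; apply: eq_bigr => x _; ring.
  rewrite exchange_big /= /Z !mulr_sumr; apply: eq_bigr => x _.
  under eq_bigr do rewrite kernel_col // mulrC -mulrA.
  rewrite -mulr_sumr sum_eq_mull /magic; field; exact: N_neq0.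
have S1 : b2 = b1 -> S = N * (b == c)%:R.
  rewrite /S => ->; rewrite -(kernel_col hK); apply: eq_bigr => j _.
  by rewrite [K j b1 * K j c]mulrC mulrACA kernel_sqr // mulr1.
have S2 : b = c -> S = N * (b2 == b1)%:R.
  rewrite /S => ->; rewrite -(kernel_col hK); apply: eq_bigr => j _.
  by rewrite [K j b1 * _]mulrC mulrACA kernel_sqr // mul1r.
rewrite !mulrA; congr (_ * _ * _ * _).
case: (eqVneq b2 b1) => [/S1->|ne].
  by case: (b == c); rewrite ?mulr0.
by case: (eqVneq b c) => [/S2->|//]; rewrite (negPf ne) !mulr0.
Qed.
End LastLetters.

Lemma push_sum K (J : finType) j2 j1 (c : J -> R) (F : J -> state) :
  push K j2 j1 (fun ys bs => \sum_j c j * F j ys bs) =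
  fun ys bs => \sum_j c j * push K j2 j1 (F j) ys bs.
Proof.
apply: funext => -[|y ys]; apply: funext => -[|b bs] /=;
  try by rewrite big1 // => j _; rewrite mulr0.
by rewrite transfer_sum mulr_sumr; apply: eq_bigr => j _; rewrite mulrCA.
Qed.

Lemma pushes_sum K (J : finType) u (c : J -> R) (F : J -> state) :
  pushes K u (fun ys bs => \sum_j c j * F j ys bs) =
  fun ys bs => \sum_j c j * pushes K u (F j) ys bs.
Proof.
have [m] := ubnP (size u); elim: m u => // m IH [|a [|b u]] //= hm.
by rewrite IH ?push_sum //; exact: ltn_trans (ltnSn _) _.
Qed.

Lemma pushesZ K u c F :
  pushes K u (fun ys bs => c * F ys bs) = fun ys bs => c * pushes K u F ys bs.
Proof.
have := pushes_sum K u (fun _ : unit => c) (fun=> F).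
set lhs := pushes _ _ _; set rhs := pushes _ _ _ => e.
transitivity lhs; last first.
  by rewrite e; apply: funext => ys; apply: funext => bs; rewrite sum_unit.
rewrite /lhs /rhs; congr pushes.
by apply: funext => ys; apply: funext => bs; rewrite sum_unit.
Qed.

(** * A functional that kills the relations *)

Definition amplitude (K' K : I -> I -> R) (w : seq (I * I)) : R :=
  if odd (size w) then 0 else
  pairing (size w)./2 (pushes K' (unzip1 w) (fun _ _ => 1))
                   (pushes K (unzip2 w) (fun _ _ => 1)).

Lemma amplitude_swap K' K w :
  amplitude K' K w = amplitude K K' [seq (s.2, s.1) | s <- w].
Proof.
rewrite /amplitude size_map; case: ifP => // _.
by rewrite pairingC /unzip1 /unzip2 -!map_comp.
Qed.

Lemma amplitude_odd K' K u v :
  odd (size u) != odd (size v) -> amplitude K' K (u ++ v) = 0.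
Proof. by rewrite /amplitude size_cat oddD; case: odd; case: odd. Qed.

Lemma amplitude_cat K' K u v : ~~ odd (size u) -> ~~ odd (size v) ->
  amplitude K' K (u ++ v) = pairing ((size u)./2 + (size v)./2)
    (pushes K' (unzip1 u) (pushes K' (unzip1 v) (fun _ _ => 1)))
    (pushes K (unzip2 u) (pushes K (unzip2 v) (fun _ _ => 1))).
Proof.
move=> hu hv; rewrite /amplitude size_cat oddD (negPf hu) (negPf hv) /=.
rewrite halfD (negPf hu) (negPf hv) /unzip1 /unzip2 !map_cat.
by rewrite !pushes_cat ?size_map.
Qed.

Lemma sum_letters (a b c d : I -> R) (g : I -> I -> I -> I -> R) :
  \sum_(s : I * I) \sum_(t : I * I)
    a s.1 * b s.2 * (c t.1 * d t.2) * g s.1 t.1 s.2 t.2 =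
  \sum_(p : I * I) a p.1 * c p.2 * \sum_(q : I * I) b q.1 * d q.2 *
    g p.1 p.2 q.1 q.2.
Proof.
transitivity (\sum_i2 \sum_j2 \sum_i1 \sum_j1
    a i2 * b j2 * (c i1 * d j1) * g i2 i1 j2 j1).
  rewrite [RHS]pair_bigA; apply: eq_bigr => s _ /=.
  by rewrite [RHS]pair_bigA.
rewrite -(pair_bigA _ (fun i2 i1 => a i2 * c i1 *
  \sum_(q : I * I) b q.1 * d q.2 * g i2 i1 q.1 q.2)) /=.
apply: eq_bigr => i2 _; rewrite exchange_big; apply: eq_bigr => i1 _ /=.
rewrite -(pair_bigA _ (fun j2 j1 => b j2 * d j1 * g i2 i1 j2 j1)) mulr_sumr /=.
apply: eq_bigr => j2 _; rewrite mulr_sumr; apply: eq_bigr => j1 _; ring.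
Qed.

Section Relations.
Variables (K' K : I -> I -> R).
Hypotheses (hK' : hadamard_kernel K') (hK : hadamard_kernel K).

(** An operator that fixes the state on one side and kills the state on the
    other forces their pairing to vanish. *)
Lemma pairing_slide_eq0 m T l u' u G' G : sliding K' K m m T T ->
    size u' = l.*2 -> size u = l.*2 ->
    T G' = G' -> T G = (fun ys bs => 0 * G ys bs) ->
  pairing (l + m) (pushes K' u' G') (pushes K u G) = 0.
Proof.
move=> hT su' su eG' eG.
by rewrite -{1}eG' (pairing_slide _ _ hT) // eG pushesZ pairingZr mul0r.
Qed.

Lemma pairing_conj m u' u (a b c d : I -> R) (G' G : I -> I -> state) :
  \sum_(s : I * I) \sum_(t : I * I) a s.1 * b s.2 * (c t.1 * d t.2) *
    pairing m (pushes K' u' (G' s.1 t.1)) (pushes K u (G s.2 t.2)) =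
  pairing m
    (pushes K' u' (fun ys bs => \sum_i \sum_k a i * c k * G' i k ys bs))
    (pushes K u (fun ys bs => \sum_j \sum_l b j * d l * G j l ys bs)).
Proof.
rewrite (sum_letters a b c d (fun i k j l =>
  pairing m (pushes K' u' (G' i k)) (pushes K u (G j l)))).
have e (e f : I -> R) (E : I -> I -> state) :
    (fun ys bs => \sum_j \sum_l e j * f l * E j l ys bs) =
    (fun ys bs => \sum_(p : I * I) e p.1 * f p.2 * E p.1 p.2 ys bs).
  by apply: funext => ys; apply: funext => bs; rewrite pair_bigA.
rewrite !e !pushes_sum pairing_suml; apply: eq_bigr => p _.
by rewrite pairing_sumr.
Qed.

Lemma fun_one_mul (F : state) : (fun ys bs => 1 * F ys bs) = F.
Proof. by apply: funext => ys; apply: funext => bs; rewrite mul1r. Qed.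

Lemma even_half n : ~~ odd n -> n = n./2.*2.
Proof. by move=> hn; rewrite -[LHS]odd_double_half (negPf hn). Qed.

(** The letters [(i, j)] and [(i, k)] are pushed together when an even number of
    letters follows them, and belong to different pairs otherwise; then the
    letters next to them, [r] and [p], complete the pairs. *)
Lemma amplitude_row_ann u v i j k : j != k ->
  amplitude K' K (u ++ (i, j) :: (i, k) :: v) = 0.
Proof.
move=> ne; case: (boolP (odd (size v))) => hv; case: (boolP (odd (size u))) => hu.
- case/lastP: u hu => // u r; rewrite size_rcons /= => hu.
  case: v hv => // p v /= hv; rewrite cat_rcons.
  rewrite amplitude_cat ?negbK //= addnS addnS -addnS -addnS.
  apply: (pairing_slide_eq0 (sliding_dup_v _ _ _)); rewrite ?size_map -?even_half //.
  + by rewrite dup_v_push2 // eqxx fun_one_mul.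
  + by rewrite dup_v_push2 // (negPf ne).
- by rewrite amplitude_odd //= hv (negPf hu).
- by rewrite amplitude_odd //= hu (negPf hv).
- rewrite amplitude_cat ?negbK //= .
  apply: (pairing_slide_eq0 (sliding_avg_w _ _ _)); rewrite ?size_map -?even_half //.
  + by rewrite avg_w_push // eqxx fun_one_mul.
  + by rewrite avg_w_push // (negPf ne).
Qed.

(** By bilinearity, the sum is one pairing of two states whose neighbouring
    letters are expressed in the dual bases. *)
Lemma amplitude_conj_row_ann u v a b c : b != c ->
  \sum_(s : I * I) \sum_(t : I * I) K' s.1 a * K s.2 b * (K' t.1 a * K t.2 c) *
    amplitude K' K (u ++ s :: t :: v) = 0.
Proof.
move=> ne; case: (boolP (odd (size v))) => hv; case: (boolP (odd (size u))) => hu.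
- case/lastP: u hu => // u r; rewrite size_rcons /= => hu.
  case: v hv => // p v /= hv.
  under eq_bigr do under eq_bigr do
    rewrite cat_rcons amplitude_cat ?negbK //= addnS addnS -addnS -addnS.
  rewrite (pairing_conj _ _ _ (K'^~ a) (K^~ b) (K'^~ a) (K^~ c) (fun s t =>
    push K' r.1 s (push K' t p.1 (pushes K' (unzip1 v) (fun _ _ => 1))))
    (fun s t => push K r.2 s (push K t p.2 (pushes K (unzip2 v) (fun _ _ => 1))))).
  apply: (pairing_slide_eq0 (sliding_dup_w _ _ _)); rewrite ?size_map -?even_half //.
  + by rewrite (dup_w_conj_push2 hK') eqxx fun_one_mul.
  + by rewrite (dup_w_conj_push2 hK) (negPf ne).
- by rewrite big1 // => s _; rewrite big1 // => t _;
    rewrite amplitude_odd ?mulr0 //= hv (negPf hu).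
- by rewrite big1 // => s _; rewrite big1 // => t _;
    rewrite amplitude_odd ?mulr0 //= hu (negPf hv).
- under eq_bigr do under eq_bigr do rewrite amplitude_cat ?negbK //=.
  rewrite (pairing_conj _ _ _ (K'^~ a) (K^~ b) (K'^~ a) (K^~ c) (fun s t =>
    push K' s t (pushes K' (unzip1 v) (fun _ _ => 1)))
    (fun s t => push K s t (pushes K (unzip2 v) (fun _ _ => 1)))).
  apply: (pairing_slide_eq0 (sliding_avg_v _ _ _)); rewrite ?size_map -?even_half //.
  + by rewrite (avg_v_conj_push hK') eqxx fun_one_mul.
  + by rewrite (avg_v_conj_push hK) (negPf ne).
Qed.

Lemma pushes_sum1 (L : I -> I -> R) (J : finType) u (F : J -> state) :
  pushes L u (fun ys bs => \sum_j F j ys bs) =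
  fun ys bs => \sum_j pushes L u (F j) ys bs.
Proof.
transitivity (pushes L u (fun ys bs => \sum_j 1 * F j ys bs)).
  congr pushes; apply: funext => ys; apply: funext => bs.
  by apply: eq_bigr => j _; rewrite mul1r.
rewrite pushes_sum; apply: funext => ys; apply: funext => bs.
by apply: eq_bigr => j _; rewrite mul1r.
Qed.

(** Contracting the letters on the side of [K] produces a [cup], which becomes a
    [cap] on the side of [K'] and compares there [i] with [k]. *)
Lemma amplitude_row_orth u v i k :
  \sum_j amplitude K' K (u ++ (i, j) :: (k, j) :: v) =
  (i == k)%:R * amplitude K' K (u ++ v).
Proof.
case: (boolP (odd (size v))) => hv; case: (boolP (odd (size u))) => hu.
- case/lastP: u hu => // u r; rewrite size_rcons /= => hu.
  case: v hv => // p v /= hv.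
  under eq_bigr do
    rewrite cat_rcons amplitude_cat ?negbK //= addnS addnS -addnS -addnS.
  rewrite cat_rcons amplitude_cat ?negbK //=.
  rewrite -pairing_sumr1 -pushes_sum1 sum_push2_cup // pushesZ pairingZr pairingC.
  have hT := sliding_comp (sliding_cup hK hK' (size v)./2.+1) (sliding_comp
    (sliding_dup_w hK hK' (size v)./2) (sliding_dup_v K K' (size v)./2)).
  rewrite (pairing_slide _ _ hT) ?size_map -?even_half //= cap_dup_push2 //.
  by rewrite !pushesZ !pairingZr mulVKf // pairingC.
- by rewrite big1 => [|j _]; rewrite amplitude_odd ?mulr0 //= hv (negPf hu).
- by rewrite big1 => [|j _]; rewrite amplitude_odd ?mulr0 //= hu (negPf hv).
- under eq_bigr do rewrite amplitude_cat ?negbK //=.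
  rewrite -pairing_sumr1 -pushes_sum1 sum_push_cup // pairingC.
  rewrite (pairing_slide _ _ (sliding_cup hK hK' _)) ?size_map -?even_half //.
  by rewrite cap_push // pushesZ pairingZr pairingC amplitude_cat.
Qed.

End Relations.

(** Vanishing on the two-sided ideal generated by the relations: the words [u]
    and [v] are the left and right multipliers. *)
Record kills_relations (K' K : I -> I -> R) (g : seq (I * I) -> R) : Prop := {
  kills_row : forall u v i k, \sum_j g (u ++ (i, j) :: (k, j) :: v) =
    (i == k)%:R * g (u ++ v) ;
  kills_col : forall u v j l, \sum_i g (u ++ (i, j) :: (i, l) :: v) =
    (j == l)%:R * g (u ++ v) ;
  kills_row_ann : forall u v i j k, j != k ->
    g (u ++ (i, j) :: (i, k) :: v) = 0 ;
  kills_col_ann : forall u v i j k, j != k ->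
    g (u ++ (j, i) :: (k, i) :: v) = 0 ;
  kills_conj_row_ann : forall u v a b c, b != c ->
    \sum_(s : I * I) \sum_(t : I * I) K' s.1 a * K s.2 b * (K' t.1 a * K t.2 c) *
      g (u ++ s :: t :: v) = 0 ;
  kills_conj_col_ann : forall u v a b c, b != c ->
    \sum_(s : I * I) \sum_(t : I * I) K' s.1 b * K s.2 a * (K' t.1 c * K t.2 a) *
      g (u ++ s :: t :: v) = 0
}.

(** The relations between columns follow from those between rows by exchanging
    the two matrices, since the pairing is symmetric. *)
Lemma amplitude_kills_relations K' K :
  hadamard_kernel K' -> hadamard_kernel K ->
  kills_relations K' K (amplitude K' K).
Proof.
move=> hK' hK; split.
- exact: amplitude_row_orth.
- move=> u v j l; under eq_bigr do rewrite amplitude_swap map_cat /=.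
  by rewrite amplitude_row_orth // [in RHS]amplitude_swap map_cat.
- exact: amplitude_row_ann.
- move=> u v i j k ne; rewrite amplitude_swap map_cat /=.
  exact: amplitude_row_ann.
- exact: amplitude_conj_row_ann.
- move=> u v a b c ne.
  pose sw (s : I * I) := (s.2, s.1).
  have swK : involutive sw by case.
  rewrite (reindex_inj (inv_inj swK)) /=.
  under eq_bigr do rewrite (reindex_inj (inv_inj swK)) /=.
  rewrite -[RHS](amplitude_conj_row_ann hK hK' (map sw u) (map sw v) a ne).
  apply: eq_bigr => s _; apply: eq_bigr => t _.
  rewrite amplitude_swap map_cat /= -!surjective_pairing; congr (_ * _); ring.
Qed.

End Transfer.

(** * The representation on functionals and the theorem *)

Section Functionals.
Variables (C : numClosedFieldType) (I : finType) (K' K : I -> I -> C).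

Definition functional_pred : {pred (seq (I * I) -> C^o)} :=
  fun g => `[< kills_relations K' K g >].

Lemma functional_submod_closed : submod_closed functional_pred.
Proof.
split=> [|c g h /asboolP [g1 g2 g3 g4 g5 g6] /asboolP [h1 h2 h3 h4 h5 h6]];
  apply/asboolP.
  suff : kills_relations K' K (fun=> 0) by [].
  by split=> *; rewrite ?mulr0 // big1 // => *; rewrite big1 // => *;
    rewrite mulr0.
have e w : (c *: g + h) w = c * g w + h w by [].
split=> [u v i k|u v j l|u v i j k ne|u v i j k ne|u v a b d ne|u v a b d ne].
- under eq_bigr do rewrite e.
  by rewrite e big_split -mulr_sumr /= g1 h1; ring.
- under eq_bigr do rewrite e.
  by rewrite e big_split -mulr_sumr /= g2 h2; ring.
- by rewrite e g3 // h3 // mulr0 addr0.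
- by rewrite e g4 // h4 // mulr0 addr0.
- under eq_bigr do under eq_bigr do rewrite e mulrDr mulrCA.
  under eq_bigr do rewrite big_split -mulr_sumr /=.
  by rewrite big_split -mulr_sumr /= g5 // h5 // mulr0 addr0.
- under eq_bigr do under eq_bigr do rewrite e mulrDr mulrCA.
  under eq_bigr do rewrite big_split -mulr_sumr /=.
  by rewrite big_split -mulr_sumr /= g6 // h6 // mulr0 addr0.
Qed.
HB.instance Definition _ := GRing.isSubmodClosed.Build _ _ functional_pred
  functional_submod_closed.

Record functional := Functional {
  functional_val :> seq (I * I) -> C^o ;
  functionalP : functional_val \in functional_pred
}.
HB.instance Definition _ := [isSub for functional_val].
HB.instance Definition _ := [Choice of functional by <:].
HB.instance Definition _ := [SubChoice_isSubLmodule of functional by <:].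

(** The functionals killing a two-sided ideal form a module. *)
Lemma kills_relations_shift g s : kills_relations K' K g ->
  kills_relations K' K (fun w => g (rcons w s)).
Proof.
case=> g1 g2 g3 g4 g5 g6; split=> u v *.
- by under eq_bigr do rewrite rcons_cat /=; rewrite g1 rcons_cat.
- by under eq_bigr do rewrite rcons_cat /=; rewrite g2 rcons_cat.
- by rewrite rcons_cat /= g3.
- by rewrite rcons_cat /= g4.
- by under eq_bigr do under eq_bigr do rewrite rcons_cat /=; rewrite g5.
- by under eq_bigr do under eq_bigr do rewrite rcons_cat /=; rewrite g6.
Qed.

Definition shift (s : I * I) (g : functional) : functional :=
  Functional (asboolT (kills_relations_shift s (asboolW (functionalP g)))).

Fact shift_linear s : linear (shift s).
Proof. by move=> a g h; apply: val_inj. Qed.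
HB.instance Definition _ s := GRing.isLinear.Build C functional functional _
  (shift s) (shift_linear s).

Lemma functional_kills (g : functional) : kills_relations K' K g.
Proof. exact: asboolW (functionalP g). Qed.

Lemma shift2E s t g w : shift s (shift t g) w = g (w ++ [:: s; t]).
Proof. by rewrite /= -!cats1 -catA. Qed.

Lemma functional_sumE (J : finType) (c : J -> C) (g : J -> functional) w :
  (\sum_j c j *: g j : functional) w = \sum_j c j * g j w.
Proof.
rewrite (big_morph (fun f : functional => (f w : C))
  (op1 := +%R) (op2 := +%R) (id1 := 0) (id2 := 0)) //.
Qed.

Lemma functional_eq (g h : functional) : g =1 h -> g = h.
Proof. by move=> e; apply/val_inj/funext. Qed.

End Functionals.

(** Size 0 stands apart because [N] is then not invertible; there are no letters
    and hence no relations. *)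
Lemma hadamard_functional (C : numClosedFieldType) N (H H' : 'M[C]_N) :
  hadamard H -> hadamard H' ->
  exists g, kills_relations (fun i a => H' a i) (fun i a => H a i) g /\
    g [::] != 0.
Proof.
case: N H H' => [|N] H H' hH hH'.
  by exists (fun=> 1); split; [split=> ? ? [] | exact: oner_neq0].
have nz : #|'I_N.+1|%:R != 0 :> C by rewrite card_ord pnatr_eq0.
have kernelP (L : 'M[C]_N.+1) : hadamard L -> hadamard_kernel (fun i a => L a i).
  move=> hL; split=> *; rewrite ?card_ord; first exact: hadamard_sqr.
    exact: hadamard_col.
  exact: hadamard_row.
exists (amplitude (fun i a => H' a i) (fun i a => H a i)); split.
  exact: amplitude_kills_relations (kernelP _ hH') (kernelP _ hH).
by rewrite /amplitude /= mulr1 oner_neq0.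
Qed.

(** Letters act on functionals by shifts, and each relation for these operators
    is the same relation inserted at the end of a word. *)
Lemma quantum_isomorphic_same_size (C : numClosedFieldType) N (H H' : 'M[C]_N) :
  hadamard H -> hadamard H' -> quantum_isomorphic H H'.
Proof.
move=> hH hH'; have [g [hg g0]] := hadamard_functional hH hH'.
pose G : functional (fun i a => H' a i) (fun i a => H a i) :=
  Functional (asboolT hg).
have G0 : G != 0.
  by apply: contra_neq g0 => /(congr1 (fun f : functional _ _ => f [::])).
pose Q := OperatorFamily (fun s => shift s : {linear _ -> _}) G0.
have sum1 (J : finType) (F : J -> op_space Q) : \sum_j F j = \sum_j 1 *: F j.
  by apply: eq_bigr => j _; rewrite scale1r.
apply: (@quantum_isomorphic_of_operators _ _ _ _ hH hH' Q).
- move=> i k f; rewrite sum1; apply: functional_eq => w.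
  rewrite functional_sumE; under eq_bigr do rewrite mul1r shift2E.
  by rewrite (kills_row (functional_kills f)) cats0.
- move=> j l f; rewrite sum1; apply: functional_eq => w.
  rewrite functional_sumE; under eq_bigr do rewrite mul1r shift2E.
  by rewrite (kills_col (functional_kills f)) cats0.
- move=> i j k f ne; apply: functional_eq => w.
  by rewrite shift2E (kills_row_ann (functional_kills f)).
- move=> i j k f ne; apply: functional_eq => w.
  by rewrite shift2E (kills_col_ann (functional_kills f)).
- move=> a b c f ne; apply: functional_eq => w.
  rewrite pair_bigA functional_sumE.
  under eq_bigr do rewrite shift2E.
  rewrite -[RHS](kills_conj_row_ann (functional_kills f) w [::] a ne).
  by rewrite [RHS]pair_bigA.
- move=> a b c f ne; apply: functional_eq => w.
  rewrite pair_bigA functional_sumE.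
  under eq_bigr do rewrite shift2E.
  rewrite -[RHS](kills_conj_col_ann (functional_kills f) w [::] a ne).
  by rewrite [RHS]pair_bigA.
Qed.

(** The sum of the squares of the entries, computed by rows and by columns. *)
Lemma orthogonal_mx_size (C : numClosedFieldType) (A : starAlgType C) m n
  (q : 'M[A]_(m, n)) : orthogonal_mx q -> m = n.
Proof.
case=> _ q1 q2.
have : \sum_i \sum_j q i j * q i j = m%:R.
  transitivity (\sum_i (q *m q^T) i i).
    by apply: eq_bigr => i _; rewrite mxE; apply: eq_bigr => j _; rewrite mxE.
  under eq_bigr do rewrite q1 mxE eqxx.
  by rewrite sumr_const card_ord.
rewrite exchange_big /=.
have -> : \sum_j \sum_i q i j * q i j = n%:R.
  transitivity (\sum_j (q^T *m q) j j).
    by apply: eq_bigr => j _; rewrite mxE; apply: eq_bigr => i _; rewrite mxE.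
  under eq_bigr do rewrite q2 mxE eqxx.
  by rewrite sumr_const card_ord.
rewrite -2!scaler_nat => /eqP; rewrite -subr_eq0 -scalerBl scaler_eq0 oner_eq0 orbF.
by rewrite subr_eq0 eqr_nat => /eqP.
Qed.

Unset Implicit Arguments.
Local Open Scope complex_scope.

Theorem theorem6p3 (R : realType) (N N' : nat) (H : 'M[R[i]]_N) (H' : 'M[R[i]]_N')
    (hH : hadamard H) (hH' : hadamard H') :
  quantum_isomorphic H H' <-> N = N'.
Proof.
split=> [[A [q [[hq _ _] _ _]]]|eN]; first exact/esym/(orthogonal_mx_size hq).
by case: _ / eN H' hH' => H' hH'; exact: quantum_isomorphic_same_size.
Qed.
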